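(* Let $G$ be a finite group, let $(Q,U)$ be a finite EI quiver with a $G$-action, and let $(\overline{Q},\overline{U})$ be its quotient EI quiver (constructed with respect to any admissible choices of $\iota_0,\iota_1,g_{(-)}$ and coset representatives, as described in the context). Then there is an equivalence of categories $$\mathcal{C}(\overline{Q},\overline{U})\simeq \mathcal{C}(Q,U)\rtimes G.$$
   Context: **Biset products.** For finite groups $G,H,K$, a $(G,H)$-biset is a set with commuting left $G$-action and right $H$-action. For a $(G,H)$-biset $X$ and an $(H,K)$-biset $Y$, $X\times_H Y$ is the quotient of $X\times Y$ by the equivalence relation generated by $(x.h,y)\sim(x,h.y)$; it is a $(G,K)$-biset; elements are written $(x,y)$. **Finite EI quivers.** A quiver $Q=(Q_0,Q_1;s,t)$ has starting and terminating vertex maps $s,t$; paths are composed from right to left. A finite EI quiver $(Q,U)$ consists of a finite acyclic quiver $Q$ (no oriented cycles) and an assignment $U$: a finite group $U(i)$ for each vertex $i$, and a finite nonempty $(U(t\alpha),U(s\alpha))$-biset $U(\alpha)$ for each arrow $\alpha$. For a path $p=\alpha_n\cdots\alpha_1$ put $U(p)=U(\alpha_n)\times_{U(t\alpha_{n-1})}\cdots\times_{U(t\alpha_1)}U(\alpha_1)$, and $U(e_i)=U(i)$ for the trivial path $e_i$. **The category $\mathcal{C}(Q,U)$.** Objects are the vertices of $Q$; $\mathrm{Hom}(i,j)=\bigsqcup_p U(p)$ over all paths $p$ from $i$ to $j$; composition is induced by concatenation of paths and the natural isomorphisms $U(p)\times_{U(tq)}U(q)\simeq U(pq)$. **$G$-action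 on $(Q,U)$.** An automorphism of $(Q,U)$ consists of a quiver automorphism $\sigma^0$ of $Q$, group isomorphisms $\sigma^1_i\colon U(i)\to U(\sigma^0(i))$ and bijections $\sigma^1_\alpha\colon U(\alpha)\to U(\sigma^0(\alpha))$ compatible with the biset structures (via $\sigma^1_{t(\alpha)},\sigma^1_{s(\alpha)}$). A $G$-action on $(Q,U)$ is a group homomorphism from $G$ to the group of automorphisms of $(Q,U)$. We write $g(i),g(\alpha)$ for the action on vertices and arrows, $g(a)\in U(g(i))$ for $a\in U(i)$, and $g(u)\in U(g(\alpha))$ for $u\in U(\alpha)$. The $G$-action induces an action of $G$ on $\mathcal{C}(Q,U)$ by categorical automorphisms. $G_i$ and $G_\alpha$ denote stabilizers. **Skew group category.** If $G$ acts on a finite category $\mathcal{C}$ by categorical automorphisms, $\mathcal{C}\rtimes G$ has the same objects as $\mathcal{C}$, $\mathrm{Hom}_{\mathcal{C}\rtimes G}(x,y)=\{(\alpha,g)\mid g\in G,\ \alpha\in\mathrm{Hom}_{\mathcal{C}}(g(x),y)\}$, and composition $(\beta,h)\circ(\alpha,g)=(\beta\circ h(\alpha),hg)$. **The quotient EI quiver $(\overline{Q},\overline{U})$.** $\overline{Q}$ is the quotient quiver: $\overline{Q}_0=Q_0/G$, $\overline{Q}_1=Q_1/G$ (orbit sets), with induced $s,t$; $\pi_0\colon Q_0\to\overline{Q}_0$ and $\pi_1\colon Q_1\to\overline{Q}_1$ are the projections. Choose maps $\iota_0\colon\overline{Q}_0\to Q_0$, $\iota_1\colon\overline{Q}_1\to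 Q_1$, $g_{(-)}\colon\overline{Q}_1\to G$ with $\pi_0\iota_0=\mathrm{Id}$, $\pi_1\iota_1=\mathrm{Id}$, and, for each $\boldsymbol{\alpha}\in\overline{Q}_1$, $t(\iota_1(\boldsymbol{\alpha}))=\iota_0(t(\boldsymbol{\alpha}))$ and $s(\iota_1(\boldsymbol{\alpha}))=g_{\boldsymbol{\alpha}}(\iota_0(s\boldsymbol{\alpha}))$. View $G_{\iota_0(t\boldsymbol{\alpha})}$ as a right $G_{\iota_1(\boldsymbol{\alpha})}$-set via inclusion, and $G_{\iota_0(s\boldsymbol{\alpha})}$ as a left $G_{\iota_1(\boldsymbol{\alpha})}$-set via $k\mapsto g_{\boldsymbol{\alpha}}^{-1}kg_{\boldsymbol{\alpha}}$. Choose coset representatives $G_{\iota_0(t\boldsymbol{\alpha})}=\bigsqcup_{r=1}^{m_{\boldsymbol{\alpha}}}h_{\boldsymbol{\alpha},r}G_{\iota_1(\boldsymbol{\alpha})}$. Every element of $G_{\iota_0(t\boldsymbol{\alpha})}\times_{G_{\iota_1(\boldsymbol{\alpha})}}G_{\iota_0(s\boldsymbol{\alpha})}$ is uniquely $(h_{\boldsymbol{\alpha},r},k)$ with $1\le r\le m_{\boldsymbol{\alpha}}$, $k\in G_{\iota_0(s\boldsymbol{\alpha})}$. Define: - for a vertex $\boldsymbol{i}$: $\overline{U}(\boldsymbol{i})=U(\iota_0(\boldsymbol{i}))\rtimes G_{\iota_0(\boldsymbol{i})}$; - for an arrow $\boldsymbol{\alpha}\colon\boldsymbol{i}\to\boldsymbol{j}$: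 $\overline{U}(\boldsymbol{\alpha})=U(\iota_1(\boldsymbol{\alpha}))\times\big(G_{\iota_0(\boldsymbol{j})}\times_{G_{\iota_1(\boldsymbol{\alpha})}}G_{\iota_0(\boldsymbol{i})}\big)$, with right action of $(a,g)\in\overline{U}(\boldsymbol{i})$ given by $(u,(h_{\boldsymbol{\alpha},r},k)).(a,g)=(u.(g_{\boldsymbol{\alpha}}k(a)),(h_{\boldsymbol{\alpha},r},kg))$, and left action of $(b,h)\in\overline{U}(\boldsymbol{j})$ given, when $hh_{\boldsymbol{\alpha},r}=h_{\boldsymbol{\alpha},p}k'$ with $k'\in G_{\iota_1(\boldsymbol{\alpha})}$, by $(b,h).(u,(h_{\boldsymbol{\alpha},r},k))=(h_{\boldsymbol{\alpha},p}^{-1}(b).k'(u),(h_{\boldsymbol{\alpha},p},g_{\boldsymbol{\alpha}}^{-1}k'g_{\boldsymbol{\alpha}}k))$. *)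

(* Defs.v *)
From HB Require Import structures.
From mathcomp Require Import all_boot all_fingroup.
From mathcomp Require Import generic_quotient.

Set Implicit Arguments.
Unset Strict Implicit.
Unset Printing Implicit Defensive.

Local Open Scope quotient_scope.
Local Open Scope group_scope.

Section LeftActions.

Variable G : finGroupType.

(* MathComp's [action] is a right action; everything here is a left action. *)
Record laction (T : Type) := LAction {
  lact_fun :> G -> T -> T;
  lact1 : forall x, lact_fun 1 x = x;
  lactM : forall g h x, lact_fun (g * h) x = lact_fun g (lact_fun h x) }.

Variables (T : finType) (to : laction T).

Definition stab_set (x : T) : {set G} := [set g | to g x == x].

Lemma stab_group_set x : group_set (stab_set x).
Proof.
apply/group_setP; split=> [|g h]; first by rewrite inE lact1.
by rewrite !inE lactM => /eqP Hg /eqP ->; rewrite Hg.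
Qed.

Canonical stab x := Group (stab_group_set x).

Lemma stabP x (g : subg_of (stab x)) : to (sgval g) x = x.
Proof. by have := subgP g; rewrite inE => /eqP. Qed.

Definition orbit_rel : rel T := fun x y => [exists g, to g x == y].

Lemma orbit_rel_equiv : equiv_class_of orbit_rel.
Proof.
split=> [x|x y|y x z].
- by apply/existsP; exists 1; rewrite lact1.
- by apply/existsP/existsP=> -[g /eqP <-]; exists g^-1;
    rewrite -lactM mulVg lact1.
- move=> /existsP[g /eqP <-] /existsP[h /eqP <-].
  by apply/existsP; exists (h * g); rewrite lactM.
Qed.

Canonical orbit_equiv := EquivRelPack orbit_rel_equiv.

Definition orb : Type := {eq_quot orbit_equiv}.
HB.instance Definition _ := EqQuotient.on orb.
HB.instance Definition _ := Finite.copy orb (can_type EquivQuot.ereprK).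

Lemma orbP x y : \pi_orb x = \pi_orb y <-> exists g, to g x = y.
Proof.
split; first by move/eqP; rewrite eqquotE => /existsP[g /eqP]; exists g.
by case=> g Dy; apply/eqP; rewrite eqquotE; apply/existsP; exists g; apply/eqP.
Qed.

End LeftActions.

Section SemidirectProduct.

(* An action of K on the group H by group automorphisms. *)
Record gaction (K H : finGroupType) := GAction {
  gact :> laction K H;
  gactM : forall k, {morph gact k : x y / x * y} }.

(* The pair (a, g) is written as in H ><| K, with product
   (b, h) (a, g) = (b h(a), h g); MathComp's [sdprod_by] is instead built
   from a right action. *)
Definition sdp (K H : finGroupType) (phi : gaction K H) : Type :=
  (H * K)%type.

Variables (K H : finGroupType) (phi : gaction K H).
Local Notation sdT := (sdp phi).

HB.instance Definition _ := Finite.copy sdT (H * K)%type.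

Definition sdp_mul (x y : sdT) : sdT := (x.1 * phi x.2 y.1, x.2 * y.2).
Definition sdp_one : sdT := (1, 1).
Definition sdp_inv (x : sdT) : sdT := (phi x.2^-1 x.1^-1, x.2^-1).

Lemma gact_1 k : phi k 1 = 1.
Proof. by apply: (mulgI (phi k 1)); rewrite -gactM !mulg1. Qed.

Lemma sdp_mulA : associative sdp_mul.
Proof.
by move=> x y z; rewrite /sdp_mul /= gactM lactM !mulgA.
Qed.

Lemma sdp_mul1 : left_id sdp_one sdp_mul.
Proof. by case=> a k; rewrite /sdp_mul /= lact1 !mul1g. Qed.

Lemma sdp_mulV : left_inverse sdp_one sdp_inv sdp_mul.
Proof.
by case=> a k; rewrite /sdp_mul /sdp_inv /= -gactM !mulVg gact_1.
Qed.

HB.instance Definition _ :=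
  Finite_isGroup.Build sdT sdp_mulA sdp_mul1 sdp_mulV.

End SemidirectProduct.

Record biset (A B : finGroupType) := Biset {
  bset :> finType;
  bl : A -> bset -> bset;
  br : bset -> B -> bset;
  bl1 : forall u, bl 1 u = u;
  blM : forall a a' u, bl (a * a') u = bl a (bl a' u);
  br1 : forall u, br u 1 = u;
  brM : forall u b b', br u (b * b') = br (br u b) b';
  blr : forall a u b, br (bl a u) b = bl a (br u b) }.

Notation "a *> u" := (bl a u) (at level 40, left associativity).
Notation "u <* b" := (br u b) (at level 40, left associativity).

(* B as a (B, A)-biset, resp. an (A, B)-biset, through f : A -> B. *)
Section RestrictedRegular.

Variables (A B : finGroupType) (f : A -> B).
Hypothesis fM : {morph f : x y / x * y}.

Lemma morph_1 : f 1 = 1.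
Proof. by apply: (mulgI (f 1)); rewrite -fM !mulg1. Qed.

Definition regr : biset B A.
Proof.
refine (@Biset B A B (fun b x => b * x) (fun x a => x * f a) _ _ _ _ _).
- exact: mul1g.
- by move=> *; rewrite mulgA.
- by move=> u; rewrite morph_1 mulg1.
- by move=> *; rewrite fM mulgA.
- by move=> *; rewrite mulgA.
Defined.

Definition regl : biset A B.
Proof.
refine (@Biset A B B (fun a x => f a * x) (fun x b => x * b) _ _ _ _ _).
- by move=> u; rewrite morph_1 mul1g.
- by move=> *; rewrite fM mulgA.
- exact: mulg1.
- by move=> *; rewrite mulgA.
- by move=> *; rewrite mulgA.
Defined.

End RestrictedRegular.

Definition reg (A : finGroupType) : biset A A :=
  @regr A A id (fun _ _ => erefl).

Section BisetProduct.

Variables (A B C : finGroupType) (X : biset A B) (Y : biset B C).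

(* p = (x.h, y) and q = (x, h.y) for some x, y and h; this relation is already
   an equivalence relation, hence equal to the one it generates. *)
Definition bprod_rel : rel (X * Y) :=
  fun p q => [exists h, (p.1 == q.1 <* h) && (q.2 == h *> p.2)].

Lemma bprod_rel_equiv : equiv_class_of bprod_rel.
Proof.
have sym p q : bprod_rel p q -> bprod_rel q p.
  move=> /existsP[h /andP[/eqP e1 /eqP e2]].
  apply/existsP; exists h^-1.
  by rewrite e1 e2 -brM -blM mulgV mulVg br1 bl1 !eqxx.
split=> [p|p q|q p r].
- by apply/existsP; exists 1; rewrite br1 bl1 !eqxx.
- by apply/idP/idP; apply: sym.
- move=> /existsP[h /andP[/eqP e1 /eqP e2]] /existsP[k /andP[/eqP e3 /eqP e4]].
  by apply/existsP; exists (k * h); rewrite e1 e4 e3 e2 brM blM !eqxx.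
Qed.

Canonical bprod_equiv := EquivRelPack bprod_rel_equiv.

Definition bprod_set : Type := {eq_quot bprod_equiv}.
HB.instance Definition _ := EqQuotient.on bprod_set.
HB.instance Definition _ :=
  Finite.copy bprod_set (can_type EquivQuot.ereprK).

Definition bpair (x : X) (y : Y) : bprod_set := \pi_bprod_set (x, y).

Lemma bpair_eqP x y x' y' :
  bpair x y = bpair x' y' <-> exists h, x = x' <* h /\ y' = h *> y.
Proof.
split.
  move=> /eqP; rewrite eqquotE => /existsP[h /andP[/eqP e1 /eqP e2]].
  by exists h.
case=> h [-> ->]; apply/eqP; rewrite eqquotE.
by apply/existsP; exists h; rewrite !eqxx.
Qed.

Lemma bpair_bal x h y : bpair (x <* h) y = bpair x (h *> y).
Proof. by apply/bpair_eqP; exists h. Qed.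

Lemma bpair_repr z : bpair (repr z).1 (repr z).2 = z.
Proof. by rewrite /bpair -surjective_pairing reprK. Qed.

Lemma bpairW (P : bprod_set -> Prop) :
  (forall x y, P (bpair x y)) -> forall z, P z.
Proof. by move=> H z; rewrite -(bpair_repr z). Qed.

Definition bprod_l (a : A) (z : bprod_set) : bprod_set :=
  bpair (a *> (repr z).1) (repr z).2.
Definition bprod_r (z : bprod_set) (c : C) : bprod_set :=
  bpair (repr z).1 ((repr z).2 <* c).

Lemma bprod_lE a x y : bprod_l a (bpair x y) = bpair (a *> x) y.
Proof.
rewrite /bprod_l; move: (bpair_repr (bpair x y)); case: (repr _) => x' y' /=.
move=> /bpair_eqP[h [-> ->]].
by rewrite -blr bpair_bal.
Qed.

Lemma bprod_rE x y c : bprod_r (bpair x y) c = bpair x (y <* c).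
Proof.
rewrite /bprod_r; move: (bpair_repr (bpair x y)); case: (repr _) => x' y' /=.
move=> /bpair_eqP[h [-> ->]].
by rewrite bpair_bal blr.
Qed.

Definition bprod : biset A C.
Proof.
refine (@Biset A C bprod_set bprod_l bprod_r _ _ _ _ _).
- by apply: bpairW=> x y; rewrite bprod_lE bl1.
- by move=> a a'; apply: bpairW=> x y; rewrite !bprod_lE blM.
- by apply: bpairW=> x y; rewrite bprod_rE br1.
- by apply: bpairW=> x y c c'; rewrite !bprod_rE brM.
- by move=> a; apply: bpairW=> x y c; rewrite !(bprod_lE, bprod_rE).
Defined.

End BisetProduct.

Record quiver := Quiver {
  vert : finType;
  arr : finType;
  src : arr -> vert;
  tgt : arr -> vert }.

(* Paths of positive length; [Cons a p] is the path a p, with p travelled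
   first. *)
Inductive npath (Q : quiver) : vert Q -> vert Q -> Type :=
| Arr (a : arr Q) : npath (src a) (tgt a)
| Cons (a : arr Q) (i : vert Q) (p : npath i (src a)) : npath i (tgt a).

Inductive qpath (Q : quiver) : vert Q -> vert Q -> Type :=
| Triv (i : vert Q) : qpath i i
| NTriv (i j : vert Q) (p : npath i j) : qpath i j.

Arguments Triv {Q} i.

Definition acyclic (Q : quiver) : Prop :=
  forall i : vert Q, npath i i -> False.

Record ei_quiver := EIQuiver {
  equiver :> quiver;
  eacyclic : acyclic equiver;
  vgrp : vert equiver -> finGroupType;
  abis : forall a : arr equiver, biset (vgrp (tgt a)) (vgrp (src a));
  abis_neq0 : forall a, 0 < #|abis a| }.

(* Decidable equality of objects makes transport of morphisms along equalities
   of objects ([hcast] below) independent of the proofs of these equalities. *)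
Record category := Category {
  obj :> eqType;
  hom : obj -> obj -> Type;
  idm : forall x, hom x x;
  mcomp : forall x y z, hom y z -> hom x y -> hom x z;
  mcomp1m : forall x y (f : hom x y), mcomp (idm y) f = f;
  mcompm1 : forall x y (f : hom x y), mcomp f (idm x) = f;
  mcompA : forall x y z t (f : hom z t) (g : hom y z) (h : hom x y),
    mcomp f (mcomp g h) = mcomp (mcomp f g) h }.

Arguments hom {c}.
Arguments idm {c}.
Arguments mcomp {c x y z}.

Record functor (C D : category) := Functor {
  fobj :> C -> D;
  fhom : forall x y, hom x y -> hom (fobj x) (fobj y);
  fhom1 : forall x, fhom (idm x) = idm (fobj x);
  fhomM : forall x y z (f : hom y z) (g : hom x y),
    fhom (mcomp f g) = mcomp (fhom f) (fhom g) }.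

Definition functor_id (C : category) : functor C C :=
  @Functor C C id (fun _ _ f => f) (fun _ => erefl) (fun _ _ _ _ _ => erefl).

Definition functor_comp (C D E : category)
  (F : functor D E) (F' : functor C D) : functor C E.
Proof.
refine (@Functor C E (fun x => F (F' x)) (fun _ _ f => fhom F (fhom F' f)) _ _).
- by move=> x; rewrite !fhom1.
- by move=> *; rewrite !fhomM.
Defined.

Definition isomorphism (C : category) (x y : C) (f : hom x y) : Prop :=
  exists g : hom y x, mcomp g f = idm x /\ mcomp f g = idm y.

Definition nat_isomorphic (C D : category) (F F' : functor C D) : Prop :=
  exists eta : forall x, hom (F x) (F' x),
    (forall x y (f : hom x y),
       mcomp (eta y) (fhom F f) = mcomp (fhom F' f) (eta x)) /\
    (forall x, isomorphism (eta x)).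

Definition cat_equivalent (C D : category) : Prop :=
  exists (F : functor C D) (F' : functor D C),
    nat_isomorphic (functor_comp F' F) (functor_id C) /\
    nat_isomorphic (functor_comp F F') (functor_id D).

Section Cast.

Variables (T : eqType) (H : T -> T -> Type).

Definition hcast x x' y y' (ex : x = x') (ey : y = y') (f : H x y) : H x' y' :=
  ecast z (H z y') ex (ecast z (H x z) ey f).

Lemma hcast_id x y (ex : x = x) (ey : y = y) f : hcast ex ey f = f.
Proof. by rewrite (eq_irrelevance ex erefl) (eq_irrelevance ey erefl). Qed.

Lemma hcast_comp x x' x'' y y' y'' (ex : x = x') (ey : y = y')
  (ex' : x' = x'') (ey' : y' = y'') f :
  hcast ex' ey' (hcast ex ey f) = hcast (etrans ex ex') (etrans ey ey') f.
Proof. by case: _ / ex'; case: _ / ey'; rewrite hcast_id. Qed.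

Lemma hcast_irr x x' y y' (ex ex' : x = x') (ey ey' : y = y') f :
  hcast ex ey f = hcast ex' ey' f.
Proof. by rewrite (eq_irrelevance ex ex') (eq_irrelevance ey ey'). Qed.

End Cast.

Arguments hcast {T H x x' y y'} : simpl never.

Section CastCat.

Lemma fhom_hcast (C D : category) (F : functor C D) x x' y y'
  (ex : x = x') (ey : y = y') (f : hom x y) :
  fhom F (hcast ex ey f) = hcast (congr1 F ex) (congr1 F ey) (fhom F f).
Proof. by case: _ / ex; case: _ / ey. Qed.

Lemma mcomp_cast_idl (C : category) (x x' y y' : C) (e e' : y = y')
  (ex : x = x') (f : hom x y) :
  mcomp (hcast e erefl (idm y)) (hcast ex e' f) = hcast ex erefl f.
Proof.
by rewrite (eq_irrelevance e' e); case: _ / e; case: _ / ex; rewrite mcomp1m.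
Qed.

Lemma mcomp_cast_idr (C : category) (x x' y : C) (e : x = x') (f : hom x y) :
  mcomp f (hcast e erefl (idm x)) = hcast e erefl f.
Proof. by case: _ / e; rewrite mcompm1. Qed.

Lemma mcomp_castl (C : category) (x x' y z : C) (e : x = x')
  (f : hom y z) (g : hom x y) :
  hcast e erefl (mcomp f g) = mcomp f (hcast e erefl g).
Proof. by case: _ / e. Qed.

Lemma mcomp_castm (C : category) (x x' y y' z : C) (e e' : y = y')
  (ex : x = x') (f : hom y z) (g : hom x y) :
  mcomp (hcast e erefl f) (hcast ex e' g) = mcomp f (hcast ex erefl g).
Proof. by rewrite (eq_irrelevance e' e); case: _ / e; case: _ / ex. Qed.

End CastCat.

Section SkewCategory.

Variables (G : finGroupType) (C : category).

Record cat_action := CatAction {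
  cact :> G -> functor C C;
  cact_obj1 : forall x, cact 1 x = x;
  cact_objM : forall g h x, cact (g * h) x = cact g (cact h x);
  cact_hom1 : forall x y (f : hom x y),
    hcast (cact_obj1 x) (cact_obj1 y) (fhom (cact 1) f) = f;
  cact_homM : forall g h x y (f : hom x y),
    hcast (cact_objM g h x) (cact_objM g h y) (fhom (cact (g * h)) f)
    = fhom (cact g) (fhom (cact h) f) }.

Variable A : cat_action.

(* The morphism (alpha, g) is [existT _ g alpha]. *)
Definition skew_hom (x y : C) : Type := {g : G & hom (A g x) y}.

Definition skew_id (x : C) : skew_hom x x :=
  existT _ 1 (hcast (esym (cact_obj1 A x)) erefl (idm x)).

Definition skew_comp x y z (b : skew_hom y z) (a : skew_hom x y) :
  skew_hom x z :=
  let: existT h beta := b in let: existT g alpha := a in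
  existT (fun k => hom (A k x) z) (h * g)
    (mcomp beta (hcast (esym (cact_objM A h g x)) erefl (fhom (A h) alpha))).

Lemma skew_eq x y g g' (e : g = g') (f : hom (A g x) y) (f' : hom (A g' x) y) :
  hcast (congr1 (fun k => A k x) e) erefl f = f' ->
  existT (fun k => hom (A k x) y) g f = existT _ g' f'.
Proof. by case: _ / e f' => f' /= <-. Qed.

Lemma cact_homME g h x y (f : hom x y) :
  fhom (A (g * h)) f = hcast (esym (cact_objM A g h x))
    (esym (cact_objM A g h y)) (fhom (A g) (fhom (A h) f)).
Proof. by rewrite -cact_homM hcast_comp hcast_id. Qed.

Lemma cact_hom1E x y (f : hom x y) :
  fhom (A 1) f = hcast (esym (cact_obj1 A x)) (esym (cact_obj1 A y)) f.
Proof. by rewrite -{2}(cact_hom1 A f) hcast_comp hcast_id. Qed.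

Definition skew_cat : category.
Proof.
refine (@Category C skew_hom skew_id skew_comp _ _ _).
- move=> x y [g f]; apply: (skew_eq (e := mul1g g)).
  rewrite cact_hom1E hcast_comp mcomp_cast_idl hcast_comp; exact: hcast_id.
- move=> x y [g f]; apply: (skew_eq (e := mulg1 g)).
  rewrite fhom_hcast fhom1 hcast_comp mcomp_cast_idr hcast_comp.
  exact: hcast_id.
- move=> x y z t [k c] [h b] [g a]; apply: (skew_eq (e := mulgA k h g)).
  rewrite fhomM fhom_hcast cact_homME !hcast_comp !mcomp_castl -mcompA.
  rewrite mcomp_castm hcast_comp.
  by congr (mcomp _ (mcomp _ _)); rewrite hcast_comp; apply: hcast_irr.
Defined.

End SkewCategory.

Section EICategory.

Variable E : ei_quiver.
Local Notation U0 := (@vgrp E).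
Local Notation U1 := (@abis E).

(* U(a p) = U(a) x_U(s a) U(p), and U(e_i) = U(i) as a (U(i), U(i))-biset. *)
Fixpoint Unp (i j : vert E) (p : npath i j) : biset (U0 j) (U0 i) :=
  match p with
  | Arr a => U1 a
  | Cons a _ p => bprod (U1 a) (Unp p)
  end.

Definition Uqp (i j : vert E) (p : qpath i j) : biset (U0 j) (U0 i) :=
  match p with
  | Triv i => reg (U0 i)
  | NTriv _ _ p => Unp p
  end.

Fixpoint ncat (i j k : vert E) (p : npath j k) : npath i j -> npath i k :=
  match p in npath j k return npath i j -> npath i k with
  | Arr a => fun q => Cons q
  | Cons _ _ p => fun q => Cons (ncat p q)
  end.

(* The map U(p) * U(q) -> U(pq) inducing U(p) x_U(tq) U(q) ~ U(pq); it is
   computed on representatives, see [nmul_Cons] and [nmul_bal]. *)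
Fixpoint nmul (i j k : vert E) (p : npath j k) :
    forall q : npath i j, Unp p -> Unp q -> Unp (ncat p q) :=
  match p in npath j k
    return forall q : npath i j, Unp p -> Unp q -> Unp (ncat p q) with
  | Arr a => fun q u v => bpair u v
  | Cons a _ p => fun q x v => bpair (repr x).1 (nmul (repr x).2 v)
  end.

Lemma nmul_l i j k (p : npath j k) (q : npath i j) a (u : Unp p) (v : Unp q) :
  nmul (a *> u) v = a *> nmul u v.
Proof.
elim: j k / p q a u v => [b|b j p IH] q a u v; first by rewrite /= bprod_lE.
have E1 (x : U1 b) (y : Unp p) :
  nmul (p := Cons p) (bpair x y) v = bpair x (nmul y v).
  rewrite /=; move: (bpair_repr (bpair x y)); case: (repr _) => x' y' /=.
  by move=> /bpair_eqP[h [-> ->]]; rewrite IH bpair_bal.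
move: u; apply: bpairW => x y.
have -> : a *> (bpair x y : Unp (Cons p)) = bpair (a *> x) y by apply: bprod_lE.
by rewrite !E1; apply/esym/bprod_lE.
Qed.

Lemma nmul_Cons i j (b : arr E) (p : npath j (src b)) (q : npath i j)
  (u : U1 b) (w : Unp p) (v : Unp q) :
  nmul (p := Cons p) (bpair u w) v = bpair u (nmul w v).
Proof.
rewrite /=; move: (bpair_repr (bpair u w)); case: (repr _) => x' y' /=.
by move=> /bpair_eqP[h [-> ->]]; rewrite nmul_l bpair_bal.
Qed.

Lemma Consl j (b : arr E) (p : npath j (src b)) a (u : U1 b) (w : Unp p) :
  a *> (bpair u w : Unp (Cons p)) = bpair (a *> u) w.
Proof. exact: bprod_lE. Qed.

Lemma Consr j (b : arr E) (p : npath j (src b)) a (u : U1 b) (w : Unp p) :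
  (bpair u w : Unp (Cons p)) <* a = bpair u (w <* a).
Proof. exact: bprod_rE. Qed.

Lemma nmul_r i j k (p : npath j k) (q : npath i j) (u : Unp p) (v : Unp q) a :
  nmul u (v <* a) = nmul u v <* a.
Proof.
elim: j k / p q u v => [b|b j p IH] q u v; first by rewrite /= bprod_rE.
move: u; apply: bpairW => x y.
by rewrite !nmul_Cons IH; apply/esym/bprod_rE.
Qed.

Lemma nmul_bal i j k (p : npath j k) (q : npath i j) (u : Unp p) a (v : Unp q) :
  nmul (u <* a) v = nmul u (a *> v).
Proof.
elim: j k / p q u a v => [b|b j p IH] q u a v; first exact: bpair_bal.
move: u; apply: bpairW => x y.
by rewrite Consr !nmul_Cons IH.
Qed.

(* Here the isomorphisms are U(j) x_U(j) U(q) ~ U(q) and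
   U(p) x_U(j) U(j) ~ U(p), given by the actions. *)
Definition qcat (i j k : vert E) (p : qpath j k) : qpath i j -> qpath i k :=
  match p in qpath j k return qpath i j -> qpath i k with
  | Triv _ => fun q => q
  | NTriv _ _ p => fun q =>
      match q in qpath i j return npath j _ -> qpath i _ with
      | Triv _ => fun p => NTriv p
      | NTriv _ _ q => fun p => NTriv (ncat p q)
      end p
  end.

Definition nqmul (i j k : vert E) (q : qpath i j) :
    forall p : npath j k, Unp p -> Uqp q -> Uqp (qcat (NTriv p) q) :=
  match q in qpath i j
    return forall p : npath j k, Unp p -> Uqp q -> Uqp (qcat (NTriv p) q) with
  | Triv _ => fun p u a => u <* a
  | NTriv _ _ q => fun p u v => nmul u v
  end.

Definition qmul (i j k : vert E) (p : qpath j k) :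
    forall q : qpath i j, Uqp p -> Uqp q -> Uqp (qcat p q) :=
  match p in qpath j k
    return forall q : qpath i j, Uqp p -> Uqp q -> Uqp (qcat p q) with
  | Triv _ => fun q a v => a *> v
  | NTriv _ _ p => fun q u v => nqmul u v
  end.

Definition ei_hom (i j : vert E) : Type := {p : qpath i j & Uqp p}.

Definition ei_id (i : vert E) : ei_hom i i :=
  existT (fun p => Uqp p) (Triv i) (1 : U0 i).

Definition ei_comp (i j k : vert E) (f : ei_hom j k) (g : ei_hom i j) :
  ei_hom i k := existT _ (qcat (tag f) (tag g)) (qmul (tagged f) (tagged g)).

(* Morphisms supported on paths of positive length. *)
Definition nhom (i j : vert E) : Type := {p : npath i j & Unp p}.
Definition nh (i j : vert E) (p : npath i j) (u : Unp p) : nhom i j :=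
  existT _ p u.
(* The morphisms of [ei_hom] given by such a path, resp. by a trivial one. *)
Definition toq (i j : vert E) (f : nhom i j) : ei_hom i j :=
  existT _ (NTriv (tag f)) (tagged f).
Definition tog (i : vert E) (a : U0 i) : ei_hom i i :=
  existT (fun p => Uqp p) (Triv i) a.
Definition ncomp (i j k : vert E) (f : nhom j k) (g : nhom i j) : nhom i k :=
  nh (nmul (tagged f) (tagged g)).
Definition nhl (i j : vert E) (a : U0 j) (f : nhom i j) : nhom i j :=
  nh (a *> tagged f).
Definition nhr (i j : vert E) (f : nhom i j) (a : U0 i) : nhom i j :=
  nh (tagged f <* a).
Definition narr (b : arr E) (u : U1 b) : nhom (src b) (tgt b) :=
  @nh _ _ (Arr b) u.

Lemma nhomW (P : forall i j, nhom i j -> Prop) :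
  (forall b (u : U1 b), P _ _ (narr u)) ->
  (forall b (u : U1 b) i (f : nhom i (src b)), P _ _ f ->
     P _ _ (ncomp (narr u) f)) ->
  forall i j (f : nhom i j), P i j f.
Proof.
move=> H1 H2 i j [p]; elim: i j / p => [b|b i p IH] u; first exact: H1.
by move: u; apply: bpairW => x y; apply: (H2 _ x _ (existT _ p y)).
Qed.

Lemma ei_homW (P : forall i j, ei_hom i j -> Prop) :
  (forall i (a : U0 i), P _ _ (tog a)) ->
  (forall i j (f : nhom i j), P _ _ (toq f)) ->
  forall i j (f : ei_hom i j), P i j f.
Proof.
move=> H1 H2 i j [p]; case: i j / p => [i|i j p] u; first exact: H1.
exact: (H2 _ _ (existT _ p u)).
Qed.

Lemma comp_gg i (a b : U0 i) : ei_comp (tog a) (tog b) = tog (a * b).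
Proof. by []. Qed.
Lemma comp_gn i j (a : U0 j) (f : nhom i j) :
  ei_comp (tog a) (toq f) = toq (nhl a f).
Proof. by []. Qed.
Lemma comp_ng i j (a : U0 i) (f : nhom i j) :
  ei_comp (toq f) (tog a) = toq (nhr f a).
Proof. by []. Qed.
Lemma comp_nn i j k (f : nhom j k) (g : nhom i j) :
  ei_comp (toq f) (toq g) = toq (ncomp f g).
Proof. by []. Qed.

Lemma nhlM i j a b (f : nhom i j) : nhl (a * b) f = nhl a (nhl b f).
Proof. by rewrite /nhl blM. Qed.
Lemma nhrM i j a b (f : nhom i j) : nhr f (a * b) = nhr (nhr f a) b.
Proof. by rewrite /nhr brM. Qed.
Lemma nhl1 i j (f : nhom i j) : nhl 1 f = f.
Proof. by case: f => p u; rewrite /nhl bl1. Qed.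
Lemma nhr1 i j (f : nhom i j) : nhr f 1 = f.
Proof. by case: f => p u; rewrite /nhr br1. Qed.
Lemma nhlr i j a b (f : nhom i j) : nhr (nhl a f) b = nhl a (nhr f b).
Proof. by rewrite /nhl /nhr /= blr. Qed.
Lemma ncomp_l i j k a (f : nhom j k) (g : nhom i j) :
  ncomp (nhl a f) g = nhl a (ncomp f g).
Proof. by rewrite /ncomp /nhl /= nmul_l. Qed.
Lemma ncomp_r i j k a (f : nhom j k) (g : nhom i j) :
  ncomp f (nhr g a) = nhr (ncomp f g) a.
Proof. by rewrite /ncomp /nhr /= nmul_r. Qed.
Lemma ncomp_bal i j k a (f : nhom j k) (g : nhom i j) :
  ncomp (nhr f a) g = ncomp f (nhl a g).
Proof. by rewrite /ncomp /nhr /nhl /= nmul_bal. Qed.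

Lemma narr_l b a (u : U1 b) : narr (a *> u) = nhl a (narr u).
Proof. by []. Qed.
Lemma narr_r b a (u : U1 b) : narr (u <* a) = nhr (narr u) a.
Proof. by []. Qed.

Lemma ncompA_arr b (u : U1 b) i j (f : nhom j (src b)) (g : nhom i j) :
  ncomp (narr u) (ncomp f g) = ncomp (ncomp (narr u) f) g.
Proof.
case: f => p v; case: g => q w; rewrite /ncomp /=.
by have /= -> := nmul_Cons u v w.
Qed.

Lemma ncompA i j k l (f : nhom k l) (g : nhom j k) (h : nhom i j) :
  ncomp f (ncomp g h) = ncomp (ncomp f g) h.
Proof.
move: k l f j i g h; apply: nhomW => [b u|b u k f IH] j i g h.
  exact: ncompA_arr.
by rewrite -ncompA_arr IH !ncompA_arr.
Qed.

Definition ei_cat : category.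
Proof.
refine (@Category (vert E) ei_hom ei_id ei_comp _ _ _).
- apply: ei_homW => [i a|i j f].
    by rewrite comp_gg mul1g.
  by rewrite comp_gn nhl1.
- apply: ei_homW => [i a|i j f].
    by rewrite comp_gg mulg1.
  by rewrite comp_ng nhr1.
- move=> x y z t f g h; move: z t f y g x h.
  apply: ei_homW => [z a|z t f] y g x h.
    move: y z g a x h; apply: ei_homW => [z b|y z g] a x h.
      move: x z h a b; apply: ei_homW => [z c|x z h] a b.
        by rewrite !comp_gg mulgA.
      by rewrite comp_gg !comp_gn nhlM.
    move: x y h g; apply: ei_homW => [y c|x y h] g.
      by rewrite comp_gn !comp_ng comp_gn nhlr.
    by rewrite comp_gn !comp_nn comp_gn ncomp_l.
  move: y z g f x h; apply: ei_homW => [z b|y z g] f x h.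
    move: x z h f b; apply: ei_homW => [z c|x z h] f b.
      by rewrite comp_gg !comp_ng nhrM.
    by rewrite comp_gn comp_ng !comp_nn ncomp_bal.
  move: x y h g; apply: ei_homW => [y c|x y h] g.
    by rewrite comp_ng !comp_nn comp_ng ncomp_r.
  by rewrite !comp_nn ncompA.
Defined.

End EICategory.

Record eiq_aut (E : ei_quiver) := EIAut {
  av : vert E -> vert E;
  aa : arr E -> arr E;
  av_bij : bijective av;
  aa_bij : bijective aa;
  aa_src : forall b, src (aa b) = av (src b);
  aa_tgt : forall b, tgt (aa b) = av (tgt b);
  avU : forall i, vgrp i -> vgrp (av i);
  aaU : forall b, abis b -> abis (aa b);
  avU_bij : forall i, bijective (@avU i);
  aaU_bij : forall b, bijective (@aaU b);
  avUM : forall i, {morph @avU i : x y / x * y};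
  aaUl : forall b x (u : abis b),
    aaU (x *> u) = ecast i (vgrp i) (esym (aa_tgt b)) (avU x) *> aaU u;
  aaUr : forall b (u : abis b) x,
    aaU (u <* x) = aaU u <* ecast i (vgrp i) (esym (aa_src b)) (avU x) }.

(* A group homomorphism from G to the automorphisms of (Q, U). The equations
   between elements of different fibres are equalities of dependent pairs. *)
Record eiq_action (G : finGroupType) (E : ei_quiver) := EIAction {
  eact :> G -> eiq_aut E;
  eact_v1 : forall i, av (eact 1) i = i;
  eact_vM : forall g h i, av (eact (g * h)) i = av (eact g) (av (eact h) i);
  eact_a1 : forall b, aa (eact 1) b = b;
  eact_aM : forall g h b, aa (eact (g * h)) b = aa (eact g) (aa (eact h) b);
  eact_U01 : forall i (x : vgrp i),
    Tagged (@vgrp E) (avU (eact 1) x) = Tagged (@vgrp E) x;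
  eact_U0M : forall g h i (x : vgrp i),
    Tagged (@vgrp E) (avU (eact (g * h)) x)
    = Tagged (@vgrp E) (avU (eact g) (avU (eact h) x));
  eact_U11 : forall b (u : abis b),
    Tagged (@abis E) (aaU (eact 1) u) = Tagged (@abis E) u;
  eact_U1M : forall g h b (u : abis b),
    Tagged (@abis E) (aaU (eact (g * h)) u)
    = Tagged (@abis E) (aaU (eact g) (aaU (eact h) u)) }.

Lemma Tagged_ecast (T : eqType) (F : T -> Type) (i j : T) (x : F i) (y : F j)
  (e : i = j) : Tagged F x = Tagged F y -> ecast k (F k) e x = y.
Proof.
move=> H; have gen (u v : {k & F k}) (p : u = v) :
  ecast k (F k) (congr1 tag p) (tagged u) = tagged v by case: _ / p.
by have /= := gen _ _ H; rewrite (eq_irrelevance (congr1 _ H) e).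
Qed.

Section AutFunctor.

Variables (E : ei_quiver) (s : eiq_aut E).

(* sigma(u_n, ..., u_1) = (sigma(u_n), ..., sigma(u_1)), computed on
   representatives, see [aut_Cons]. *)
Fixpoint aut_np i j (p : @npath E i j) : Unp p -> nhom (av s i) (av s j) :=
  match p in npath i j return Unp p -> nhom (av s i) (av s j) with
  | Arr b => fun u => hcast (aa_src s b) (aa_tgt s b) (narr (aaU s u))
  | Cons b _ p => fun x =>
      hcast erefl (aa_tgt s b)
        (ncomp (narr (aaU s (repr x).1))
           (hcast erefl (esym (aa_src s b)) (aut_np (repr x).2)))
  end.

Definition aut_nhom i j (f : @nhom E i j) : nhom (av s i) (av s j) :=
  aut_np (tagged f).

Definition aut_hom i j (f : @ei_hom E i j) : ei_hom (av s i) (av s j) :=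
  let: existT p u := f in
  match p in qpath i j return Uqp p -> ei_hom (av s i) (av s j) with
  | Triv i => fun a => tog (avU s (a : vgrp i))
  | NTriv _ _ p => fun u => toq (aut_np u)
  end u.

Lemma hcast_nhl i i' j j' (ei : i = i') (ej : j = j') a (f : @nhom E i j) :
  hcast ei ej (nhl a f) = nhl (ecast k (vgrp k) ej a) (hcast ei ej f).
Proof. by case: _ / ei; case: _ / ej. Qed.

Lemma hcast_nhr i i' j j' (ei : i = i') (ej : j = j') a (f : @nhom E i j) :
  hcast ei ej (nhr f a) = nhr (hcast ei ej f) (ecast k (vgrp k) ei a).
Proof. by case: _ / ei; case: _ / ej. Qed.

Lemma hcast_ncomp i i' j j' k k' (ei : i = i') (ej : j = j') (ek : k = k')
  (f : @nhom E j k) (g : nhom i j) :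
  hcast ei ek (ncomp f g) = ncomp (hcast ej ek f) (hcast ei ej g).
Proof. by case: _ / ei; case: _ / ej; case: _ / ek. Qed.

Lemma ecastK (T : eqType) (F : T -> Type) i j
  (e : i = j) (e' : j = i) (x : F i) :
  ecast k (F k) e' (ecast k (F k) e x) = x.
Proof.
by move: e'; case: _ / e => e'; rewrite (eq_irrelevance e' erefl).
Qed.

Lemma aut_narr b (u : @abis E b) :
  aut_nhom (narr u) = hcast (aa_src s b) (aa_tgt s b) (narr (aaU s u)).
Proof. by []. Qed.

Lemma aut_Cons b (u : @abis E b) i (p : npath i (src b)) (w : Unp p) :
  (forall a (v : Unp p), aut_np (a *> v) = nhl (avU s a) (aut_np v)) ->
  aut_nhom (ncomp (narr u) (nh w)) = ncomp (aut_nhom (narr u)) (aut_np w).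
Proof.
move=> H; rewrite /aut_nhom /=.
move: (bpair_repr (bpair u w)); case: (repr _) => u' w' /=.
move=> /bpair_eqP[h [-> ->]].
rewrite aaUr narr_r ncomp_bal H. rewrite -hcast_nhl.
by rewrite (hcast_ncomp erefl (aa_src s b)) hcast_comp hcast_id.
Qed.

Lemma aut_np_l i j (p : @npath E i j) a (u : Unp p) :
  aut_np (a *> u) = nhl (avU s a) (aut_np u).
Proof.
elim: i j / p a u => [b|b i p IH] a u.
  by rewrite /= aaUl narr_l hcast_nhl ecastK.
move: u; apply: bpairW => u w; rewrite Consl.
have E1 v : aut_np (p := Cons p) (bpair v w)
  = ncomp (aut_nhom (narr v)) (aut_np w) := aut_Cons v w IH.
by rewrite !E1 -ncomp_l !aut_narr aaUl narr_l hcast_nhl ecastK.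
Qed.

Lemma aut_l i j a (f : @nhom E i j) :
  aut_nhom (nhl a f) = nhl (avU s a) (aut_nhom f).
Proof. exact: aut_np_l. Qed.

Lemma aut_comp_arr b (u : @abis E b) i (f : nhom i (src b)) :
  aut_nhom (ncomp (narr u) f) = ncomp (aut_nhom (narr u)) (aut_nhom f).
Proof. by case: f => p w; apply: aut_Cons; apply: aut_np_l. Qed.

Lemma aut_r i j a (f : @nhom E i j) :
  aut_nhom (nhr f a) = nhr (aut_nhom f) (avU s a).
Proof.
move: i j f a; apply: nhomW => [b u|b u i f IH] a.
  by rewrite -narr_r !aut_narr aaUr narr_r hcast_nhr ecastK.
by rewrite -ncomp_r !aut_comp_arr IH ncomp_r.
Qed.

Lemma aut_comp i j k (f : @nhom E j k) (g : nhom i j) :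
  aut_nhom (ncomp f g) = ncomp (aut_nhom f) (aut_nhom g).
Proof.
move: j k f i g; apply: nhomW => [b u|b u j f IH] i g.
  exact: aut_comp_arr.
by rewrite -ncompA !aut_comp_arr IH ncompA.
Qed.

Lemma avU1 i : avU s (1 : @vgrp E i) = 1.
Proof. by apply: (mulgI (avU s (1 : vgrp i))); rewrite -avUM !mulg1. Qed.

Definition aut_functor : functor (ei_cat E) (ei_cat E).
Proof.
refine (@Functor (ei_cat E) (ei_cat E) (av s) aut_hom _ _).
- by move=> i; rewrite /= /ei_id -avU1.
- move=> i j k f g; move: j k f i g.
  apply: ei_homW => [j a|j k f] i g.
    move: i j g a; apply: ei_homW => [i b|i j g] a.
      by rewrite /= avUM.
    by rewrite [aut_hom (toq g)]/= [RHS]comp_gn -/(aut_nhom g) -aut_l.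
  move: i j g f; apply: ei_homW => [i b|i j g] f.
    by rewrite [aut_hom (toq f)]/= [RHS]comp_ng -/(aut_nhom f) -aut_r.
  rewrite [aut_hom (toq f)]/= [aut_hom (toq g)]/= [RHS]comp_nn.
  by rewrite -/(aut_nhom f) -/(aut_nhom g) -aut_comp.
Defined.

End AutFunctor.

Section InducedAction.

Variables (G : finGroupType) (E : ei_quiver) (A : eiq_action G E).

Lemma narr_cast (b b' : arr E) (u : abis b) (u' : abis b') (e : b = b') :
  Tagged (@abis E) u = Tagged (@abis E) u' ->
  hcast (congr1 (@src E) e) (congr1 (@tgt E) e) (narr u) = narr u'.
Proof.
move=> H; have := Tagged_ecast e H.
by case: _ / e u' H => u' _ /= ->.
Qed.

Lemma aut_nhom_hcast (s : eiq_aut E) i i' j j' (ei : i = i') (ej : j = j')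
  (f : @nhom E i j) :
  aut_nhom s (hcast ei ej f)
  = hcast (congr1 (av s) ei) (congr1 (av s) ej) (aut_nhom s f).
Proof. by case: _ / ei; case: _ / ej. Qed.

Lemma eact_nhom1 i j (f : @nhom E i j) (ei : av (A 1) i = i)
  (ej : av (A 1) j = j) : hcast ei ej (aut_nhom (A 1) f) = f.
Proof.
move: i j f ei ej; apply: nhomW => [b u|b u i f IH] ei ej.
  rewrite aut_narr hcast_comp -[RHS](narr_cast (eact_a1 A b) (eact_U11 A u)).
  exact: hcast_irr.
rewrite aut_comp_arr (hcast_ncomp _ (eact_v1 A (src b))) IH; congr ncomp.
rewrite aut_narr hcast_comp -[RHS](narr_cast (eact_a1 A b) (eact_U11 A u)).
exact: hcast_irr.
Qed.

Lemma eact_nhomM g h i j (f : @nhom E i j)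
  (ei : av (A (g * h)) i = av (A g) (av (A h) i))
  (ej : av (A (g * h)) j = av (A g) (av (A h) j)) :
  hcast ei ej (aut_nhom (A (g * h)) f)
  = aut_nhom (A g) (aut_nhom (A h) f).
Proof.
have Harr b (u : abis b) (es : av (A (g * h)) (src b) = _) et :
  hcast es et (aut_nhom (A (g * h)) (narr u))
  = aut_nhom (A g) (aut_nhom (A h) (narr u)).
  rewrite !aut_narr aut_nhom_hcast aut_narr !hcast_comp.
  rewrite -(narr_cast (eact_aM A g h b) (eact_U1M A g h u)) hcast_comp.
  exact: hcast_irr.
move: i j f ei ej; apply: nhomW => [b u|b u i f IH] ei ej; first exact: Harr.
rewrite !aut_comp_arr aut_comp (hcast_ncomp _ (eact_vM A g h (src b))).
by rewrite IH Harr.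
Qed.

Lemma hcast_toq i i' j j' (ei : i = i') (ej : j = j') (f : @nhom E i j) :
  hcast ei ej (toq f) = toq (hcast ei ej f).
Proof. by case: _ / ei; case: _ / ej. Qed.

Lemma hcast_tog i i' (e e' : i = i') (a : @vgrp E i) :
  hcast e e' (tog a) = tog (ecast k (vgrp k) e a).
Proof. by rewrite (eq_irrelevance e' e); case: _ / e. Qed.

Definition ei_cat_action : cat_action G (ei_cat E).
Proof.
refine (@CatAction G (ei_cat E) (fun g => aut_functor (A g))
  (eact_v1 A) (eact_vM A) _ _).
- apply: ei_homW => [i a|i j f].
    by rewrite [LHS]hcast_tog (Tagged_ecast _ (eact_U01 A a)).
  by rewrite [LHS]hcast_toq -/(aut_nhom _ f) eact_nhom1.
- move=> g h; apply: ei_homW => [i a|i j f].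
    by rewrite [LHS]hcast_tog (Tagged_ecast _ (eact_U0M A g h a)).
  by rewrite [LHS]hcast_toq -/(aut_nhom _ f) eact_nhomM.
Defined.

End InducedAction.

Section QuotientQuiver.

Variables (G : finGroupType) (E : ei_quiver) (A : eiq_action G E).

Definition vact : laction G (vert E) :=
  @LAction G _ (fun g => av (A g)) (eact_v1 A) (eact_vM A).
Definition aact : laction G (arr E) :=
  @LAction G _ (fun g => aa (A g)) (eact_a1 A) (eact_aM A).

(* The maps x |-> g(x) with the index of the fibre of g(x) rewritten. *)
Definition actv g i j (e : vact g i = j) (x : vgrp i) : vgrp j :=
  ecast k (vgrp k) e (avU (A g) x).
Definition acta g b c (e : aact g b = c) (u : @abis E b) : abis c :=
  ecast d (abis d) e (aaU (A g) u).

Lemma actvM g i j (e : vact g i = j) : {morph actv e : x y / x * y}.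
Proof. by move=> x y; rewrite /actv avUM; case: _ / e. Qed.

Lemma actv1 i (e : vact 1 i = i) x : actv e x = x.
Proof. exact: Tagged_ecast (eact_U01 A x). Qed.

Lemma actv_comp g h k i i' i'' (e : vact g i' = i'') (e' : vact h i = i')
  (e'' : vact k i = i'') x : g * h = k -> actv e (actv e' x) = actv e'' x.
Proof.
move=> Dk; subst k; case: _ / e' e => e; rewrite [actv erefl x]/=.
case: _ / e e'' => e''; apply/esym; exact: Tagged_ecast (eact_U0M A g h x).
Qed.

Lemma actv_ecast i j (e : i = j) (e' : vact 1 i = j) (x : @vgrp E i) :
  ecast k (vgrp k) e x = actv e' x.
Proof. by case: _ / e e' => e'; rewrite actv1. Qed.

Lemma acta1 b (e : aact 1 b = b) u : acta e u = u.
Proof. exact: Tagged_ecast (eact_U11 A u). Qed.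

Lemma acta_comp g h k b b' b'' (e : aact g b' = b'') (e' : aact h b = b')
  (e'' : aact k b = b'') u : g * h = k -> acta e (acta e' u) = acta e'' u.
Proof.
move=> Dk; subst k; case: _ / e' e => e; rewrite [acta erefl u]/=.
case: _ / e e'' => e''; apply/esym; exact: Tagged_ecast (eact_U1M A g h u).
Qed.

Lemma acta_l g b c (e : aact g b = c) (e' : vact g (tgt b) = tgt c) x u :
  acta e (x *> u) = actv e' x *> acta e u.
Proof.
rewrite /acta aaUl /actv; move: e'; case: _ / e => e' /=.
by rewrite (eq_irrelevance e' (esym (aa_tgt (A g) b))).
Qed.

Lemma acta_r g b c (e : aact g b = c) (e' : vact g (src b) = src c) u x :
  acta e (u <* x) = acta e u <* actv e' x.
Proof.
rewrite /acta aaUr /actv; move: e'; case: _ / e => e' /=.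
by rewrite (eq_irrelevance e' (esym (aa_src (A g) b))).
Qed.

Definition stab_laction i : laction (subg_of (stab vact i)) (vgrp i).
Proof.
refine (@LAction _ _ (fun k x => actv (stabP k) x) _ _).
- exact: actv1.
- by move=> g h x; rewrite (actv_comp _ _ (stabP (g * h))).
Defined.

Definition stab_gaction i : gaction (subg_of (stab vact i)) (vgrp i) :=
  @GAction _ _ (stab_laction i) (fun k => actvM (stabP k)).

Definition qsrc (b : orb aact) : orb vact := \pi_(orb vact) (src (repr b)).
Definition qtgt (b : orb aact) : orb vact := \pi_(orb vact) (tgt (repr b)).

Lemma qsrcE b : qsrc (\pi_(orb aact) b) = \pi_(orb vact) (src b).
Proof.
rewrite /qsrc.
move: (reprK (\pi_(orb aact) b)); move: (repr _) => b' /orbP[g <-].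
by apply/orbP; exists g; rewrite /= aa_src.
Qed.

Lemma qtgtE b : qtgt (\pi_(orb aact) b) = \pi_(orb vact) (tgt b).
Proof.
rewrite /qtgt.
move: (reprK (\pi_(orb aact) b)); move: (repr _) => b' /orbP[g <-].
by apply/orbP; exists g; rewrite /= aa_tgt.
Qed.

Definition quot_quiver : quiver := Quiver qsrc qtgt.

Lemma npath_act g i j :
  @npath E i j -> inhabited (@npath E (vact g i) (vact g j)).
Proof.
elim: i j / => [b|b i p [q]].
  by rewrite /= -aa_src -aa_tgt; constructor; apply: Arr.
by rewrite /= -aa_tgt; constructor; apply: Cons; rewrite aa_src.
Qed.

Lemma npath_lift i j : @npath quot_quiver i j ->
  forall y : vert E, \pi_(orb vact) y = j ->
  exists2 x, \pi_(orb vact) x = i & inhabited (@npath E x y).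
Proof.
have lift (b : orb aact) (y : vert E) : \pi_(orb vact) y = qtgt b ->
    exists2 c, \pi_(orb aact) c = b & tgt c = y.
  rewrite -[b]reprK qtgtE => /esym/orbP[g <-].
  exists (aact g (repr b)); last by rewrite /= aa_tgt.
  by apply/esym/orbP; exists g.
elim: i j / => [b|b i p IH] y /lift[d Dd <-].
  exists (src d); first by rewrite /= -Dd qsrcE.
  by constructor; apply: Arr.
have [|x Dx [q]] := IH (src d); first by rewrite /= -Dd qsrcE.
by exists x => //; constructor; apply: Cons.
Qed.

Lemma quot_acyclic : acyclic quot_quiver.
Proof.
move=> i p; have [x Dx [q]] := npath_lift p (reprK i).
have /orbP[g Dg] : \pi_(orb vact) x = \pi_(orb vact) (repr i).
  by rewrite Dx reprK.
have step n : inhabited (@npath E x (vact (g ^+ n.+1) x)).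
  elim: n => [|n [r]]; first by rewrite expg1 Dg.
  have [r'] := npath_act g r.
  rewrite expgS lactM; constructor.
  by rewrite -Dg in q; apply: ncat q.
have [r] := step #[g].-1.
move: r; rewrite prednK ?order_gt0 // expg_order lact1.
exact: eacyclic.
Qed.

(* [gsh b] is the element g_b of G and [cosrep b r] the representative h_(b,r),
   for r < [ncos b]. *)
Record quot_choice := QuotChoice {
  iota0 : orb vact -> vert E;
  iota1 : orb aact -> arr E;
  gsh : orb aact -> G;
  iota0K : forall i, \pi_(orb vact) (iota0 i) = i;
  iota1K : forall b, \pi_(orb aact) (iota1 b) = b;
  iota_tgt : forall b, tgt (iota1 b) = iota0 (qtgt b);
  iota_src : forall b, src (iota1 b) = vact (gsh b) (iota0 (qsrc b));
  ncos : orb aact -> nat;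
  cosrep : forall b, 'I_(ncos b) -> subg_of (stab vact (iota0 (qtgt b)));
  cosrepP : forall b (x : subg_of (stab vact (iota0 (qtgt b)))),
    exists! r : 'I_(ncos b),
      sgval x \in sgval (cosrep r) *: stab aact (iota1 b) }.

Variable c : quot_choice.

Definition quot_vgrp (i : orb vact) : finGroupType :=
  sdp (stab_gaction (iota0 c i)).

Section QuotientBiset.

Variable b : orb aact.
Local Notation Gt := (subg_of (stab vact (iota0 c (qtgt b)))).
Local Notation Gs := (subg_of (stab vact (iota0 c (qsrc b)))).
Local Notation Ga := (subg_of (stab aact (iota1 c b))).
Local Notation rep := (@cosrep c b).

Lemma stab_tgt (k : Ga) : sgval k \in stab vact (iota0 c (qtgt b)).
Proof. by rewrite inE -iota_tgt /= -aa_tgt; have /= -> := stabP k. Qed.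

Lemma stab_src (k : Ga) : sgval k ^ gsh c b \in stab vact (iota0 c (qsrc b)).
Proof.
rewrite inE conjgE !lactM -iota_src /= -aa_src; have /= -> := stabP k.
have Hg : vact (gsh c b)^-1 (vact (gsh c b) (iota0 c (qsrc b)))
  = iota0 c (qsrc b).
  by rewrite -lactM mulVg lact1.
by rewrite iota_src; apply/eqP.
Qed.

Definition incl_t (k : Ga) : Gt := Subg (stab_tgt k).
Definition conj_s (k : Ga) : Gs := Subg (stab_src k).

Lemma incl_tM : {morph incl_t : x y / x * y}.
Proof. by move=> x y; apply: val_inj. Qed.
Lemma conj_sM : {morph conj_s : x y / x * y}.
Proof. by move=> x y; apply: val_inj; rewrite /= conjMg. Qed.

(* G_(iota0 (t b)) x_(G_(iota1 b)) G_(iota0 (s b)), where k in G_(iota1 b) acts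
   on the right factor as k ^ g_b = g_b^-1 k g_b. *)
Definition coset_prod : biset Gt Gs := bprod (regr incl_tM) (regl conj_sM).
Definition cpair (h : Gt) (k : Gs) : coset_prod :=
  bpair (h : regr incl_tM) (k : regl conj_sM).

Lemma cos_ex (x : Gt) : exists rk : 'I_(ncos c b) * Ga,
  x == rep rk.1 * incl_t rk.2.
Proof.
have [r [/lcosetP[k kin Dx] _]] := cosrepP x.
by exists (r, Subg kin); apply/eqP/val_inj.
Qed.

(* The pair (p, k') with x = h_p k'. *)
Definition cosd (x : Gt) : 'I_(ncos c b) * Ga := xchoose (cos_ex x).

Lemma cosdP x : x = rep (cosd x).1 * incl_t (cosd x).2.
Proof. exact: (eqP (xchooseP (cos_ex x))). Qed.

Lemma incl_t_inj : injective incl_t.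
Proof. by move=> x y /(congr1 val) /= H; apply: val_inj. Qed.

Lemma rep_inj r r' k k' :
  rep r * incl_t k = rep r' * incl_t k' -> (r, k) = (r', k').
Proof.
move=> H; have [q [_ Hq]] := cosrepP (rep r * incl_t k).
have Er : r = r'.
  rewrite -(Hq r) ?(Hq r') //; last by rewrite mem_lcoset /= mulKg subgP.
  by rewrite H mem_lcoset /= mulKg subgP.
by subst r'; move/mulgI/incl_t_inj: H => ->.
Qed.

Lemma cosdE r k : cosd (rep r * incl_t k) = (r, k).
Proof.
by apply/esym; rewrite [RHS]surjective_pairing; apply: rep_inj; rewrite -cosdP.
Qed.

Lemma bdec_ex (z : coset_prod) : exists rk : 'I_(ncos c b) * Gs,
  z == cpair (rep rk.1) rk.2.
Proof.
move: z; apply: bpairW => x k.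
exists ((cosd x).1, conj_s (cosd x).2 * k); rewrite /= {1}(cosdP x).
by apply/eqP; apply: (bpair_bal (X := regr incl_tM) (Y := regl conj_sM)).
Qed.

(* The pair (r, k) with z = (h_r, k). *)
Definition bdec (z : coset_prod) : 'I_(ncos c b) * Gs := xchoose (bdec_ex z).

Lemma bdecP z : z = cpair (rep (bdec z).1) (bdec z).2.
Proof. exact: (eqP (xchooseP (bdec_ex z))). Qed.

Lemma bdecE r k : bdec (cpair (rep r) k) = (r, k).
Proof.
have := bdecP (cpair (rep r) k); case: (bdec _) => r' k' /= /bpair_eqP[h /=].
case=> H ->; have [-> h1] : (r, 1) = (r', h) by apply: rep_inj; rewrite -H
  (_ : incl_t 1 = 1) ?mulg1 //; apply: val_inj.
by rewrite -h1 (_ : conj_s 1 = 1) ?mul1g //; apply: val_inj; rewrite /= conj1g.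
Qed.

Definition quot_set : finType := (abis (iota1 c b) * coset_prod)%type.

(* (u, (h_r, k)) (a, g) = (u g_b(k(a)), (h_r, k g)). *)
Definition quot_r (x : quot_set) (y : quot_vgrp (qsrc b)) : quot_set :=
  let: (u, z) := x in let: (a, g) := y in let: (r, k) := bdec z in
  (u <* actv (esym (iota_src c b)) (actv (stabP k) a), cpair (rep r) (k * g)).

(* (a, h) (u, (h_r, k)) = (h_p^-1(a) k'(u), (h_p, g_b^-1 k' g_b k)), where
   h h_r = h_p k'. *)
Definition quot_l (y : quot_vgrp (qtgt b)) (x : quot_set) : quot_set :=
  let: (u, z) := x in let: (a, h) := y in let: (r, k) := bdec z in
  let: (p, k') := cosd (h * rep r) in
  (ecast i (vgrp i) (esym (iota_tgt c b)) (actv (stabP (rep p)^-1) a)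
     *> acta (stabP k') u,
   cpair (rep p) (conj_s k' * k)).

Arguments quot_r _ _ : simpl never.
Arguments quot_l _ _ : simpl never.

Lemma quot_rE u r k a g :
  quot_r (u, cpair (rep r) k) (a, g)
  = (u <* actv (esym (iota_src c b)) (actv (stabP k) a),
     cpair (rep r) (k * g)).
Proof. by rewrite /quot_r bdecE. Qed.

Lemma quot_lE u r k a h p k' : h * rep r = rep p * incl_t k' ->
  quot_l (a, h) (u, cpair (rep r) k)
  = (ecast i (vgrp i) (esym (iota_tgt c b)) (actv (stabP (rep p)^-1) a)
       *> acta (stabP k') u,
     cpair (rep p) (conj_s k' * k)).
Proof. by move=> H; rewrite /quot_l bdecE H cosdE. Qed.

Lemma quot_setW (P : quot_set -> Prop) :
  (forall u r k, P (u, cpair (rep r) k)) -> forall x, P x.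
Proof. by move=> H [u z]; rewrite (bdecP z). Qed.

Lemma actv_triv g i j (e : vact g i = j) : actv e 1 = 1.
Proof. by apply: (mulgI (actv e 1)); rewrite -actvM !mulg1. Qed.

Definition quot_biset : biset (quot_vgrp (qtgt b)) (quot_vgrp (qsrc b)).
Proof.
refine (@Biset _ _ quot_set quot_l quot_r _ _ _ _ _).
- apply: quot_setW => u r k.
  have H1 : (1 : Gt) * rep r = rep r * incl_t 1.
    by rewrite mul1g (morph_1 incl_tM) mulg1.
  rewrite (quot_lE u k 1 H1) actv_triv (morph_1 conj_sM) mul1g.
  by rewrite acta1 (_ : ecast _ _ _ _ = 1) ?bl1 //; case: _ / (esym _).
- move=> [x h] [x' h']; apply: quot_setW => u r k.
  have := cosdP (h' * rep r); case: (cosd _) => p k' /= H'.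
  have := cosdP (h * rep p); case: (cosd _) => q k'' /= H.
  have HH : (h * h') * rep r = rep q * incl_t (k'' * k').
    by rewrite -mulgA H' mulgA H incl_tM mulgA.
  rewrite (quot_lE u k x' H') (quot_lE _ _ _ H).
  rewrite [LHS](quot_lE u k (x * actv (stabP h) x') HH).
  rewrite conj_sM mulgA; congr pair.
  have et : vact (sgval k'') (tgt (iota1 c b)) = tgt (iota1 c b).
    by rewrite /= -aa_tgt; have /= -> := stabP k''.
  rewrite (acta_l _ et) -blM.
  rewrite -(acta_comp (stabP k'') (stabP k')) //; congr (_ *> _).
  have e1 := etrans (eact_v1 A _) (esym (iota_tgt c b)).
  rewrite !(actv_ecast _ e1) !actvM; congr (_ * _).
  pose e3 (g : Gt) : vact (sgval g) (iota0 c (qtgt b)) = tgt (iota1 c b) :=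
    etrans (stabP g) (esym (iota_tgt c b)).
  rewrite (actv_comp _ _ (stabP ((rep q)^-1 * h))) //.
  rewrite (actv_comp _ _ (e3 ((rep q)^-1 * h))) ?mul1g //.
  rewrite (actv_comp e1 _ (e3 (rep p)^-1)) ?mul1g //.
  rewrite (actv_comp _ _ (e3 ((rep q)^-1 * h))) //.
  have Hk : incl_t k'' * (rep p)^-1 = (rep q)^-1 * h.
    by apply: (mulgI (rep q)); rewrite !mulgA -H mulgV mul1g mulgK.
  exact: (congr1 sgval Hk).
- apply: quot_setW => u r k.
  by rewrite quot_rE !actv_triv br1 mulg1.
- apply: quot_setW => u r k [x g] [x' g'].
  rewrite !quot_rE /= -brM mulgA !actvM; congr (_ <* (_ * _), _).
  by congr actv; rewrite (actv_comp _ _ (stabP (k * g))).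
- move=> [x h]; apply: quot_setW => u r k [x' g].
  have := cosdP (h * rep r); case: (cosd _) => p k' /= H.
  rewrite quot_rE !(quot_lE _ _ _ H) quot_rE blr -mulgA; congr (_ *> _, _).
  have es : vact (sgval k') (src (iota1 c b)) = src (iota1 c b).
    by rewrite /= -aa_src; have /= -> := stabP k'.
  have e4 : vact (gsh c b * sgval (conj_s k' * k)) (iota0 c (qsrc b))
              = src (iota1 c b).
    by rewrite lactM (stabP (conj_s k' * k)) -iota_src.
  rewrite (acta_r _ es); congr (_ <* _).
  have e5 : vact (sgval k' * gsh c b) (iota0 c (qsrc b)) = src (iota1 c b).
    by rewrite lactM -iota_src.
  rewrite [LHS](actv_comp _ _ e4) // (actv_comp _ _ e5) //; apply/esym.
  by apply: actv_comp; rewrite /= conjgE !mulgA mulgV mul1g.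
Defined.

End QuotientBiset.

Lemma quot_biset_neq0 b : 0 < #|quot_biset b|.
Proof.
have /card_gt0P[u _] := abis_neq0 (iota1 c b).
by apply/card_gt0P; exists (u, cpair 1 1).
Qed.

Definition quot_eiq : ei_quiver :=
  @EIQuiver quot_quiver quot_acyclic quot_vgrp quot_biset quot_biset_neq0.

End QuotientQuiver.

(* Main.v *)
From Stdlib Require Import IndefiniteDescription.
From mathcomp Require Import all_boot all_fingroup.
From mathcomp Require Import generic_quotient.
Require Import Defs.

(** Write C for C(Q, U), C' for C(Qbar, Ubar) and D for the skew category of C.
    The equivalence is a functor F : C' -> D which is the section [iota0] on
    objects, keeps the pairs (a, g) that are the automorphisms of a vertex, and
    sends the element (u, (h_r, k)) of Ubar(b) to the morphism
    (h_r(u), h_r g_b k), that is, to the composite in D of k, g_b, u and h_r.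
    The category of an EI quiver is free: a functor out of it is the same as
    compatible group and biset maps on vertices and arrows ([ext_functor]), and
    for the above assignments the compatibility is [qfun_grpM], [qfun_arr_l] and
    [qfun_arr_r].

    F is essentially surjective because every vertex is the translate of a
    chosen one by some g in G, and (id, g) is invertible in D
    ([skew_translation_iso]).

    Full faithfulness rests on two uniqueness facts. In C, a morphism that
    is not an element of a vertex group has an outermost arrow, and its
    expression as u f with u in some U(b) is unique up to replacing (u, f) by
    (u h, h^-1 f) with h in U(s b) ([unique_factorization]). In Q, an arrow that
    ends at a chosen vertex iota0(j) is h_r(iota1(beta)) for exactly one beta
    ending at j and exactly one coset representative h_r ([arrow_translate] and
    [arrow_translate_inj]). Hence the outermost arrow of a morphism of D
    between chosen vertices lifts to C' in one way, up to the group of the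
    middle vertex, and induction on the number of arrows lifts the whole
    morphism ([qfun_full]) and shows that two lifts agree ([qfun_tot_inj]).

    Both C and D compare morphisms whose ends are equal only provably. All
    computations therefore take place in the total space of morphisms ([tot]),
    where transports disappear and G acts strictly. *)

Set Implicit Arguments.
Unset Strict Implicit.
Unset Printing Implicit Defensive.

Local Open Scope quotient_scope.
Local Open Scope group_scope.

(** * Morphisms with varying ends *)

Lemma Tagged_inj (T : eqType) (F : T -> Type) (i : T) (x y : F i) :
  Tagged F x = Tagged F y -> x = y.
Proof. exact: (Tagged_ecast erefl). Qed.

Lemma TaggedE (T : eqType) (F : T -> Type) (i j : T) (e : i = j) (x : F i) :
  Tagged F (ecast k (F k) e x) = Tagged F x.
Proof. by case: _ / e. Qed.

Section Total.

Variable C : category.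

(** An equation [tot f = tot f'] is the heterogeneous equality of f and f': it
    says that their ends agree and that they are equal after transport. *)
Definition tot (x y : C) (f : hom x y) : {p : C * C & hom p.1 p.2} :=
  Tagged (fun p : C * C => hom p.1 p.2) (i := (x, y)) f.

Lemma tot_inj (x y : C) (f f' : hom x y) : tot f = tot f' -> f = f'.
Proof. exact: Tagged_inj. Qed.

Lemma tot_hcast (x x' y y' : C) (ex : x = x') (ey : y = y') (f : hom x y) :
  tot (hcast ex ey f) = tot f.
Proof. by case: _ / ex; case: _ / ey. Qed.

Lemma totP (x y x' y' : C) (f : hom x y) (f' : hom x' y') :
  tot f = tot f' -> exists (ex : x = x') (ey : y = y'), hcast ex ey f = f'.
Proof.
move=> H; case: (congr1 tag H) => /= ex ey.
exists ex, ey; apply: tot_inj; rewrite tot_hcast; exact: H.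
Qed.

Lemma tot_comp (x y z x' y' z' : C) (f : hom y z) (g : hom x y)
  (f' : hom y' z') (g' : hom x' y') :
  tot f = tot f' -> tot g = tot g' -> tot (mcomp f g) = tot (mcomp f' g').
Proof.
move=> /totP[ey [ez <-]] /totP[ex [ey' <-]].
rewrite (eq_irrelevance ey' ey).
by case: _ / ex; case: _ / ey ey'; case: _ / ez.
Qed.

Lemma tot_idm (x y : C) : x = y -> tot (idm x) = tot (idm y).
Proof. by move->. Qed.

End Total.

Lemma tot_fhom (C D : category) (F : functor C D) (x y x' y' : C)
  (f : hom x y) (f' : hom x' y') :
  tot f = tot f' -> tot (fhom F f) = tot (fhom F f').
Proof. by move=> /totP[ex [ey <-]]; case: _ / ex; case: _ / ey. Qed.

(** * Fully faithful and essentially surjective functors *)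

Section FullyFaithful.

Variables (C D : category) (F : functor C D).
Hypothesis full : forall x y (g : hom (F x) (F y)), exists f, fhom F f = g.
Hypothesis faithful :
  forall x y (f f' : hom x y), fhom F f = fhom F f' -> f = f'.
Hypothesis ess_surj : forall y : D, exists x (f : hom (F x) y), isomorphism f.

(** The hypotheses only assert existence, whereas the inverse functor is data:
    choice picks an object o(y) with an isomorphism e : F (o(y)) -> y for each
    y, and a preimage L(g) of each morphism g. *)
Lemma fully_faithful_equivalent : cat_equivalent C D.
Proof.
have ch1 (y : D) : {x : C & {f : hom (F x) y & {g : hom y (F x) |
    mcomp g f = idm _ /\ mcomp f g = idm _}}}.
  have /constructive_indefinite_description[x Hx] := ess_surj y; exists x.
  have /constructive_indefinite_description[f Hf] := Hx; exists f.
  exact: constructive_indefinite_description Hf.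
pose L x y (g : hom (F x) (F y)) : hom x y :=
  sval (constructive_indefinite_description _ (full g)).
have LK x y (g : hom (F x) (F y)) : fhom F (L _ _ g) = g.
  by rewrite /L; case: (constructive_indefinite_description _ _).
pose o y := projT1 (ch1 y).
pose e y : hom (F (o y)) y := projT1 (projT2 (ch1 y)).
pose e' y : hom y (F (o y)) := sval (projT2 (projT2 (ch1 y))).
have e'e y : mcomp (e' y) (e y) = idm _.
  exact: proj1 (svalP (projT2 (projT2 (ch1 y)))).
have ee' y : mcomp (e y) (e' y) = idm _.
  exact: proj2 (svalP (projT2 (projT2 (ch1 y)))).
clearbody o e e' L.
pose Gh x y (g : hom x y) : hom (o x) (o y) :=
  L _ _ (mcomp (e' y) (mcomp g (e x))).
have Gh1 x : Gh _ _ (idm x) = idm (o x).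
  by apply: faithful; rewrite LK mcomp1m e'e fhom1.
have GhM x y z (f : hom y z) (g : hom x y) :
    Gh _ _ (mcomp f g) = mcomp (Gh _ _ f) (Gh _ _ g).
  apply: faithful; rewrite fhomM !LK -!mcompA.
  by rewrite (mcompA (e y) (e' y)) ee' mcomp1m.
exists F, (Functor Gh1 GhM); split.
- exists (fun x => L _ _ (e (F x))); split=> [x y f|x].
    apply: faithful; rewrite /= !fhomM !LK.
    by rewrite mcompA ee' mcomp1m.
  exists (L _ _ (e' (F x))).
  by rewrite /=; split; apply: faithful; rewrite fhomM !LK fhom1 ?e'e ?ee'.
- exists e; split=> [x y f|x] /=.
    by rewrite LK mcompA ee' mcomp1m.
  by exists (e' x).
Qed.

End FullyFaithful.

(* Simplification must not replace composition in a concrete category by its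
   definition, which the lemmas on categories do not match. *)
Local Arguments mcomp : simpl never.
Local Arguments idm : simpl never.
Local Arguments fhom : simpl never.

(** * Unique factorization in the category of an EI quiver *)

Section EiCat.

Variable E : ei_quiver.

Definition earr (b : arr E) (u : abis b) : @hom (ei_cat E) (src b) (tgt b) :=
  toq (narr u).
Definition egrp (i : vert E) (a : vgrp i) : @hom (ei_cat E) i i := tog a.

Lemma egrp1 i : egrp (1 : vgrp i) = idm (i : ei_cat E).
Proof. by []. Qed.
Lemma egrpM i (a b : @vgrp E i) : mcomp (egrp a) (egrp b) = egrp (a * b).
Proof. by []. Qed.
Lemma earr_l (b : arr E) a (u : abis b) :
  mcomp (egrp a) (earr u) = earr (a *> u).
Proof. by []. Qed.
Lemma earr_r (b : arr E) a (u : abis b) :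
  mcomp (earr u) (egrp a) = earr (u <* a).
Proof. by []. Qed.

(** Induction on the number of arrows. The one-arrow paths need no case of their
    own, because u in U(b) is the composite of u and an identity. *)
Lemma ei_hom_ind (P : forall i j, @hom (ei_cat E) i j -> Prop) :
  (forall i (a : @vgrp E i), P _ _ (egrp a)) ->
  (forall (b : arr E) (u : abis b) i (f : @hom (ei_cat E) i (src b)),
     P _ _ f -> P _ _ (mcomp (earr u) f)) ->
  forall i j f, P i j f.
Proof.
move=> H0 H1; apply: ei_homW => // i j; move: i j.
apply: (@nhomW E (fun i j f => P i j (toq f))) => [b u|b u i f IH].
  by have := H1 b u _ _ (H0 _ 1); rewrite earr_r br1.
exact: (H1 b u i (toq f)).
Qed.

Lemma tot_egrp i j (a : @vgrp E i) (b : @vgrp E j) :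
  Tagged (@vgrp E) a = Tagged (@vgrp E) b -> tot (egrp a) = tot (egrp b).
Proof.
move=> H; have e : i = j := congr1 tag H.
move: b H; case: _ / e => b H; by rewrite (Tagged_inj H).
Qed.

Lemma tot_earr b c (u : @abis E b) (v : @abis E c) :
  Tagged (@abis E) u = Tagged (@abis E) v -> tot (earr u) = tot (earr v).
Proof.
move=> H; have e : b = c := congr1 tag H.
move: v H; case: _ / e => v H; by rewrite (Tagged_inj H).
Qed.

(** [Tagged_inj] does not apply to the fibres of [ei_hom], since paths carry no
    decidable equality; recovering the components of a morphism takes functions
    defined by matching on its path, such as this one. *)
Definition group_part i j (f : @ei_hom E i j) : option {i : vert E & vgrp i} :=
  let: existT p u := f in
  match p in qpath i j return Uqp p -> option {i : vert E & vgrp i} with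
  | Triv i => fun a => Some (Tagged (@vgrp E) (a : vgrp i))
  | NTriv _ _ _ => fun _ => None
  end u.

Lemma tot_egrp_inj i j (a : @vgrp E i) (b : @vgrp E j) :
  tot (egrp a) = tot (egrp b) -> Tagged (@vgrp E) a = Tagged (@vgrp E) b.
Proof.
pose t (f : {p : ei_cat E * ei_cat E & hom p.1 p.2}) := group_part (tagged f).
by move=> /(congr1 t) /Some_inj.
Qed.

(** The pairs (u, f) of a first factor and a remainder, over all arrows and all
    starting vertices at once. *)
Definition factorization : Type :=
  {b : arr E & (abis b * {i : vert E & @hom (ei_cat E) i (src b)})%type}.

Definition mk_factn (b : arr E) (u : abis b) i
    (f : @hom (ei_cat E) i (src b)) : factorization :=
  existT (fun b => (abis b * {i : vert E & @hom (ei_cat E) i (src b)})%type) b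
    (u, Tagged (fun i => @hom (ei_cat E) i (src b)) f).

Lemma mk_factn_inj (b : arr E) (u u' : abis b) i i'
  (f : @hom (ei_cat E) i (src b)) (f' : @hom (ei_cat E) i' (src b)) :
  mk_factn u f = mk_factn u' f' -> u = u' /\ tot f = tot f'.
Proof.
move=> /(@Tagged_inj _ _ _ _ _) K.
have /= Hu := congr1 fst K; have /= Hf := congr1 snd K; split=> //.
have e : i = i' := congr1 tag Hf.
by move: f' Hf {K}; case: _ / e => f' /(@Tagged_inj _ _ _ _ _) ->.
Qed.

(** The factorization through the last arrow of the path that is read off the
    chosen representatives; it is one of the many with the same composite. *)
Definition nfactor i j (p : npath i j) : @Unp E i j p -> factorization :=
  match p in npath i j return Unp p -> factorization with
  | Arr b => fun u => mk_factn u (egrp 1)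
  | Cons b _ p => fun x => mk_factn (repr x).1 (toq (nh (repr x).2))
  end.

Definition qfactor i j (f : @ei_hom E i j) : option factorization :=
  let: existT p u := f in
  match p in qpath i j return Uqp p -> option factorization with
  | Triv _ => fun _ => None
  | NTriv _ _ p => fun u => Some (nfactor u)
  end u.

Definition tfactor (f : {p : ei_cat E * ei_cat E & hom p.1 p.2}) :
  option factorization := qfactor (tagged f).

(** The chosen representative of the class of (u, f) can only differ from it by
    an element of the middle group. *)
Lemma tfactor_comp (b : arr E) (u : abis b) i (f : @hom (ei_cat E) i (src b)) :
  exists h : vgrp (src b),
    tfactor (tot (mcomp (earr u) f))
    = Some (mk_factn (u <* h) (mcomp (egrp h^-1) f)).
Proof.
(* The target of f has to be a variable before f can be analysed by cases. *)
suff gen j (e : src b = j) (g : @hom (ei_cat E) i j) :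
  exists h : vgrp (src b),
    tfactor (tot (mcomp (earr u) (hcast erefl (esym e) g)))
    = Some (mk_factn (u <* h) (mcomp (egrp h^-1) (hcast erefl (esym e) g))).
  by have := gen _ erefl f; rewrite hcast_id.
move: i j g b u e {f}; apply: ei_homW => [i a|i j f] b u e.
  rewrite -[tog a]/(egrp a); move: a; case: _ / e => a; exists a.
  by rewrite hcast_id egrpM mulVg.
move: f; case: _ / e => f; rewrite hcast_id.
case: f => p w.
move: (bpair_repr (bpair u w)).
rewrite /mcomp /tfactor /=.
case: (repr _) => u' w' /= /bpair_eqP[h [-> ->]].
by exists h; rewrite comp_gn /nhl /= -blM mulVg bl1.
Qed.

(** Both composites have the same chosen factorization, from which (u, f) and
    (u', f') differ by elements h and h' of the middle group, hence from each
    other by h h'^-1. *)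
Lemma unique_factorization (b b' : arr E) (u : abis b) (u' : abis b') i i'
  (f : @hom (ei_cat E) i (src b)) (f' : @hom (ei_cat E) i' (src b')) :
  tot (mcomp (earr u) f) = tot (mcomp (earr u') f') ->
  exists h : vgrp (src b),
    mk_factn u' f' = mk_factn (u <* h) (mcomp (egrp h^-1) f).
Proof.
move=> H; have [h Hh] := tfactor_comp u f; have [h' Hh'] := tfactor_comp u' f'.
move: Hh; rewrite H Hh' => /Some_inj {}H.
have e : b' = b := congr1 tag H.
move: u f h H; case: _ / e => u f h /(@Tagged_inj _ _ _ _ _) K.
have /= Hu := congr1 fst K; have /= Hf := congr1 snd K.
have e : i' = i := congr1 tag Hf.
move: f Hf {K}; case: _ / e => f /(@Tagged_inj _ _ _ _ _) Hf.
exists (h * h'^-1); rewrite brM -Hu -brM mulgV br1.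
by rewrite invMg invgK -egrpM -mcompA -Hf mcompA egrpM mulgV egrp1 mcomp1m.
Qed.

End EiCat.

(** * The universal property of the category of an EI quiver *)

Section UniversalProperty.

Variables (E : ei_quiver) (D : category) (Fo : vert E -> D).
Variable F0 : forall i, vgrp i -> @hom D (Fo i) (Fo i).
Variable F1 : forall b : arr E, abis b -> @hom D (Fo (src b)) (Fo (tgt b)).
Hypothesis F0_1 : forall i, F0 (1 : vgrp i) = idm (Fo i).
Hypothesis F0M : forall i (a b : vgrp i), F0 (a * b) = mcomp (F0 a) (F0 b).
Hypothesis F1l : forall (b : arr E) a (u : abis b),
  F1 (a *> u) = mcomp (F0 a) (F1 u).
Hypothesis F1r : forall (b : arr E) (u : abis b) a,
  F1 (u <* a) = mcomp (F1 u) (F0 a).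

(** Computed on representatives; [F1r] and [ext_np_l] make it independent
    of them, which is the content of [ext_arr]. *)
Fixpoint ext_np i j (p : @npath E i j) : Unp p -> @hom D (Fo i) (Fo j) :=
  match p in npath i j return Unp p -> @hom D (Fo i) (Fo j) with
  | Arr b => fun u => F1 u
  | Cons b _ p => fun x => mcomp (F1 (repr x).1) (ext_np (repr x).2)
  end.

Definition ext_hom i j (f : @ei_hom E i j) : @hom D (Fo i) (Fo j) :=
  let: existT p u := f in
  match p in qpath i j return Uqp p -> @hom D (Fo i) (Fo j) with
  | Triv i => fun a => F0 (a : vgrp i)
  | NTriv _ _ p => fun u => ext_np u
  end u.

Let extn i j (f : @nhom E i j) := ext_hom (toq f).

Lemma ext_np_l i j (p : @npath E i j) a (u : Unp p) :
  ext_np (a *> u) = mcomp (F0 a) (ext_np u).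
Proof.
elim: i j / p a u => [b|b i p IH] a u; first exact: F1l.
have E1 v w : ext_np (p := Cons p) (bpair v w) = mcomp (F1 v) (ext_np w).
  rewrite /=; move: (bpair_repr (bpair v w)); case: (repr _) => v' w' /=.
  by move=> /bpair_eqP[h [-> ->]]; rewrite IH F1r mcompA.
by move: u; apply: bpairW => v w; rewrite Consl !E1 F1l mcompA.
Qed.

Lemma ext_arr b (u : abis b) i (f : @nhom E i (src b)) :
  extn (ncomp (narr u) f) = mcomp (F1 u) (extn f).
Proof.
case: f => p w; rewrite /extn /=.
move: (bpair_repr (bpair u w)); case: (repr _) => v' w' /=.
by move=> /bpair_eqP[h [-> ->]]; rewrite ext_np_l F1r mcompA.
Qed.

Lemma ext_l i j a (f : @nhom E i j) : extn (nhl a f) = mcomp (F0 a) (extn f).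
Proof. exact: ext_np_l. Qed.

Lemma ext_r i j a (f : @nhom E i j) : extn (nhr f a) = mcomp (extn f) (F0 a).
Proof.
move: i j f a; apply: nhomW => [b u|b u i f IH] a; first exact: F1r.
by rewrite -ncomp_r !ext_arr IH mcompA.
Qed.

Lemma ext_comp i j k (f : @nhom E j k) (g : nhom i j) :
  extn (ncomp f g) = mcomp (extn f) (extn g).
Proof.
move: j k f i g; apply: nhomW => [b u|b u j f IH] i g; first exact: ext_arr.
by rewrite -ncompA !ext_arr IH mcompA.
Qed.

Definition ext_functor : functor (ei_cat E) D.
Proof.
refine (@Functor (ei_cat E) D Fo ext_hom _ _); first exact: F0_1.
move=> i j k f g; move: j k f i g; apply: ei_homW => [j a|j k f] i g.
  move: i j g a; apply: ei_homW => [i b|i j g] a; first exact: F0M.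
  exact: ext_l.
move: i j g f; apply: ei_homW => [i b|i j g] f; first exact: ext_r.
exact: ext_comp.
Defined.

End UniversalProperty.

(** * Skew group categories without transports *)

Section Skew.

Variables (G : finGroupType) (C : category) (A : cat_action G C).

Lemma skew_ext (x y : C) (f f' : skew_hom A x y) :
  tag f = tag f' -> tot (tagged f) = tot (tagged f') -> f = f'.
Proof.
case: f => g f; case: f' => g' f' /= e H.
by apply: (skew_eq (e := e)); apply: tot_inj; rewrite tot_hcast.
Qed.

Lemma tag_skew_comp (x y z : C) (b : skew_hom A y z) (a : skew_hom A x y) :
  tag (skew_comp b a) = tag b * tag a.
Proof. by case: b; case: a. Qed.

Lemma tot_skew_comp (x y z : C) (b : skew_hom A y z) (a : skew_hom A x y) :
  tot (tagged (skew_comp b a))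
  = tot (mcomp (tagged b) (fhom (A (tag b)) (tagged a))).
Proof.
by case: b => h b; case: a => g a /=; rewrite -mcomp_castl tot_hcast.
Qed.

Lemma tot_cact1 (x y : C) (f : hom x y) : tot (fhom (A 1) f) = tot f.
Proof. by rewrite -{2}(cact_hom1 A f) tot_hcast. Qed.

Lemma tot_cactM g h (x y : C) (f : hom x y) :
  tot (fhom (A (g * h)) f) = tot (fhom (A g) (fhom (A h) f)).
Proof. by rewrite -cact_homM tot_hcast. Qed.

Lemma tot_cact_inj g (x y x' y' : C) (f : hom x y) (f' : hom x' y') :
  tot (fhom (A g) f) = tot (fhom (A g) f') -> tot f = tot f'.
Proof.
move=> /(tot_fhom (A g^-1)) H.
by rewrite -(tot_cact1 f) -(tot_cact1 f') -(mulVg g) !tot_cactM; exact: H.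
Qed.

(** The inverse of (id, g) is (id, g^-1). *)
Lemma skew_translation_iso g (x y : C) (e : A g x = y) :
  @isomorphism (skew_cat A) x y (existT _ g (hcast (esym e) erefl (idm y))).
Proof.
have inv (h : G) (z t : C) (Ez : A h z = t) (Et : A h^-1 t = z) :
    skew_comp (existT (fun k => hom (A k t) z) h^-1
                 (hcast (esym Et) erefl (idm z)))
              (existT (fun k => hom (A k z) t) h
                 (hcast (esym Ez) erefl (idm t))) = skew_id A z.
  apply: skew_ext; first by rewrite tag_skew_comp /= mulVg.
  rewrite tot_skew_comp [RHS]tot_hcast /=.
  rewrite -[RHS](congr1 (@tot _ _ _) (mcomp1m _)).
  apply: tot_comp; first exact: tot_hcast.
  rewrite (tot_fhom _ (tot_hcast _ _ _)) fhom1; exact: tot_idm.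
have e' : A g^-1 y = x by rewrite -e -cact_objM mulVg cact_obj1.
exists (existT _ g^-1 (hcast (esym e') erefl (idm x))); split; first exact: inv.
(* The other composite is the same statement for g^-1, up to g^-1^-1 = g. *)
have e2 : A g^-1^-1 x = y by rewrite invgK.
rewrite -[RHS](inv g^-1 y x e' e2); congr skew_comp.
apply: skew_ext; first by rewrite /= invgK.
by rewrite /= !tot_hcast.
Qed.

End Skew.

(** * Lifting arrows to the quotient quiver *)

Section Quotient.

Variables (G : finGroupType) (E : ei_quiver) (A : eiq_action G E).
Variable c : quot_choice A.

Local Notation CA := (ei_cat_action A).
Local Notation D := (skew_cat CA).
Local Notation rep := (@cosrep _ _ _ c _).

(** An element h of G with h(iota1(beta)) = b0 exists because beta is the orbit
    of b0. As both arrows end at iota0(j), h fixes this vertex, so that it may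
    be replaced by the representative of its coset. *)
Lemma arrow_translate (b0 : arr E) j : tgt b0 = iota0 c j ->
  exists (beta : orb (aact A)) (r : 'I_(ncos c beta)),
    qtgt beta = j /\ aact A (sgval (rep r)) (iota1 c beta) = b0.
Proof.
move=> Tb0; pose beta : orb (aact A) := \pi_(orb (aact A)) b0.
have Ej : qtgt beta = j by rewrite qtgtE Tb0 iota0K.
have [h Dh] : exists h, aact A h (iota1 c beta) = b0.
  by apply/orbP; rewrite iota1K.
exists beta; have hP : h \in stab (vact A) (iota0 c (qtgt beta)).
  by rewrite inE -iota_tgt /= -aa_tgt [aa _ _]Dh iota_tgt Ej Tb0.
have [r [/lcosetP[s Hs /= Dhs] _]] := cosrepP (Subg hP : subg_of _).
exists r; split; first exact: Ej.
rewrite -[RHS]Dh Dhs lactM; congr (aact A _ _); apply/esym/eqP.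
by move: Hs; rewrite inE.
Qed.

(** Translates of iota1(b) and iota1(b') can only be equal if b and b' are the
    same orbit; two elements that move iota1(b) to the same place lie in one
    coset of its stabilizer. *)
Lemma arrow_translate_inj (b b' : orb (aact A))
  (r : 'I_(ncos c b)) (r' : 'I_(ncos c b')) :
  aact A (sgval (rep r')) (iota1 c b') = aact A (sgval (rep r)) (iota1 c b) ->
  Tagged (fun b => 'I_(ncos c b)) r' = Tagged (fun b => 'I_(ncos c b)) r.
Proof.
move=> ec; have eb : b' = b.
  rewrite -(iota1K c b') -(iota1K c b); apply/orbP.
  exists ((sgval (rep r))^-1 * sgval (rep r')).
  by rewrite lactM ec -lactM mulVg lact1.
subst b'; congr Tagged; have [q [_ Hq]] := cosrepP (rep r').
rewrite -(Hq r') ?lcoset_refl // (Hq r) // mem_lcoset inE lactM.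
by rewrite ec -lactM mulVg lact1.
Qed.

(** * The functor to the skew group category *)

Lemma tot_actv g i j (e : vact A g i = j) (x : vgrp i) :
  tot (egrp (actv e x)) = tot (fhom (CA g) (egrp x)).
Proof. by apply: tot_egrp; apply: TaggedE. Qed.

Lemma tot_cact_earr g (b : arr E) (u : abis b) :
  tot (fhom (CA g) (earr u)) = tot (earr (aaU (A g) u)).
Proof.
by rewrite /fhom /= -hcast_toq -[LHS]/(tot (C := ei_cat E) _) tot_hcast.
Qed.

Lemma tot_acta g b d (e : aact A g b = d) (u : abis b) :
  tot (earr (acta e u)) = tot (fhom (CA g) (earr u)).
Proof. by rewrite tot_cact_earr; apply: tot_earr; apply: TaggedE. Qed.

Definition qfun_grp (i : vert (quot_eiq c)) (x : vgrp i) :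
  @hom D (iota0 c i) (iota0 c i) :=
  existT (fun k => hom (CA k (iota0 c i)) (iota0 c i)) (sgval x.2)
    (hcast (esym (stabP x.2)) erefl (egrp x.1)).

Lemma qfun_grp_tot i (x : @vgrp (quot_eiq c) i) :
  tot (tagged (qfun_grp x)) = tot (egrp x.1).
Proof. exact: tot_hcast. Qed.

Lemma qfun_arr_src (b : orb (aact A)) (r : 'I_(ncos c b))
  (k : subg_of (stab (vact A) (iota0 c (qsrc b)))) :
  CA (sgval (rep r)) (src (iota1 c b))
  = CA (sgval (rep r) * gsh c b * sgval k) (iota0 c (qsrc b)).
Proof. by rewrite iota_src !cact_objM [CA (sgval k) _](stabP k). Qed.

Lemma qfun_arr_tgt (b : orb (aact A)) (r : 'I_(ncos c b)) :
  CA (sgval (rep r)) (tgt (iota1 c b)) = iota0 c (qtgt b).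
Proof. by rewrite iota_tgt [LHS](stabP (rep r)). Qed.

(** The composite h_r u g_b k in the skew category: h_r(u) is a morphism from
    h_r(s(iota1 b)) = h_r g_b k(iota0(s b)) to h_r(t(iota1 b)) = iota0(t b). *)
Definition qfun_arr (b : arr (quot_eiq c)) (x : abis b) :
  @hom D (iota0 c (src b)) (iota0 c (tgt b)) :=
  let rk := bdec x.2 in
  existT (fun k => hom (CA k (iota0 c (src b))) (iota0 c (tgt b)))
    (sgval (rep rk.1) * gsh c b * sgval rk.2)
    (hcast (qfun_arr_src rk.1 rk.2) (qfun_arr_tgt rk.1)
       (fhom (CA (sgval (rep rk.1))) (earr x.1))).

Lemma qfun_arr_tag (b : arr (quot_eiq c)) u r k :
  tag (@qfun_arr b (u, cpair (rep r) k)) = sgval (rep r) * gsh c b * sgval k.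
Proof. by rewrite /qfun_arr /= bdecE. Qed.

Lemma qfun_arr_tot (b : arr (quot_eiq c)) u r k :
  tot (tagged (@qfun_arr b (u, cpair (rep r) k)))
  = tot (fhom (CA (sgval (rep r))) (earr u)).
Proof. by rewrite [LHS]tot_hcast /= bdecE. Qed.

Lemma qfun_grp1 i : qfun_grp (1 : @vgrp (quot_eiq c) i) = idm (iota0 c i : D).
Proof. by apply: skew_ext => //; rewrite qfun_grp_tot [RHS]tot_hcast. Qed.

Lemma qfun_grpM i (x y : @vgrp (quot_eiq c) i) :
  qfun_grp (x * y) = mcomp (qfun_grp x) (qfun_grp y).
Proof.
apply: skew_ext; first by rewrite [RHS]tag_skew_comp.
rewrite [RHS]tot_skew_comp qfun_grp_tot -[egrp _]egrpM.
apply: tot_comp; first by rewrite qfun_grp_tot.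
rewrite (tot_fhom _ (qfun_grp_tot y)); exact: tot_actv.
Qed.

(** Moving (a, g) past h_r g_b k turns a into h_r(g_b(k(a))), which is why the
    right action on Ubar(b) multiplies u by g_b(k(a)). *)
Lemma qfun_arr_r (b : arr (quot_eiq c)) (x : abis b) (y : vgrp (src b)) :
  qfun_arr (x <* y) = mcomp (qfun_arr x) (qfun_grp y).
Proof.
move: x y; apply: quot_setW => u r k [a g].
rewrite [X in qfun_arr X](quot_rE u r k a g).
apply: skew_ext.
  by rewrite [RHS]tag_skew_comp [LHS]qfun_arr_tag qfun_arr_tag /= !mulgA.
rewrite [RHS]tot_skew_comp qfun_arr_tot -earr_r fhomM.
apply: tot_comp; first by rewrite qfun_arr_tot.
rewrite (tot_fhom _ (qfun_grp_tot _)) qfun_arr_tag -mulgA !tot_cactM.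
apply: tot_fhom; rewrite tot_actv tot_cactM; apply: tot_fhom; exact: tot_actv.
Qed.

(** With h h_r = h_p k', the group parts agree since
    h_p g_b (g_b^-1 k' g_b) k = h h_r g_b k, and the morphisms agree since
    h_p(h_p^-1(a) k'(u)) = a h(h_r(u)). *)
Lemma qfun_arr_l (b : arr (quot_eiq c)) (y : vgrp (tgt b)) (x : abis b) :
  qfun_arr (y *> x) = mcomp (qfun_grp y) (qfun_arr x).
Proof.
move: x y; apply: quot_setW => u r k [a h].
have := cosdP (h * rep r); case: (cosd _) => p k' /= H.
rewrite [X in qfun_arr X](quot_lE u k a H).
have HG : sgval h * sgval (rep r) = sgval (rep p) * sgval k'.
  exact: (congr1 sgval H).
apply: skew_ext.
  have Hc : sgval (conj_s k' * k) = sgval k' ^ gsh c b * sgval k by [].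
  rewrite [RHS]tag_skew_comp [LHS]qfun_arr_tag qfun_arr_tag Hc conjgE.
  rewrite !mulgA mulgK.
  by rewrite [tag _]/= HG.
rewrite [RHS]tot_skew_comp qfun_arr_tot -earr_l fhomM.
apply: tot_comp.
  have -> : tot (tagged (qfun_grp (a, h))) = tot (egrp a) := qfun_grp_tot _.
  rewrite -[RHS](tot_cact1 CA) -(mulgV (sgval (rep p))) tot_cactM.
  apply: tot_fhom; rewrite -(tot_actv (stabP (rep p)^-1)).
  by apply: tot_egrp; apply: TaggedE.
rewrite (tot_fhom _ (qfun_arr_tot _ _ _)) -tot_cactM.
have -> : tag (qfun_grp (a, h)) * sgval (rep r)
  = sgval (rep p) * sgval k' := HG.
rewrite tot_cactM; apply: tot_fhom; exact: tot_acta.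
Qed.

Definition qfun : functor (ei_cat (quot_eiq c)) D :=
  ext_functor qfun_grp1 qfun_grpM qfun_arr_l qfun_arr_r.

Lemma qfun_earr (b : arr (quot_eiq c)) (x : abis b) i
  (f : @hom (ei_cat (quot_eiq c)) i (src b)) :
  fhom qfun (mcomp (earr x) f) = mcomp (qfun_arr x) (fhom qfun f).
Proof. exact: (fhomM qfun (earr x) f). Qed.

Lemma qfun_egrp i (x : @vgrp (quot_eiq c) i) : fhom qfun (egrp x) = qfun_grp x.
Proof. by []. Qed.

(** * Essential surjectivity and full faithfulness *)

Lemma qfun_ess_surj (y : D) : exists x (f : hom (qfun x) y), isomorphism f.
Proof.
have [g Dg] : exists g, vact A g (iota0 c (\pi_(orb (vact A)) y)) = y.
  by apply/orbP; rewrite iota0K.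
have Dg' : CA g (iota0 c (\pi_(orb (vact A)) y)) = y := Dg.
exists (\pi_(orb (vact A)) y).
exact: ex_intro _ _ (skew_translation_iso Dg').
Qed.

(** Fullness is the case l = 1. The induction removes the last arrow of f,
    after which the target is a translate of a chosen vertex but not a chosen
    vertex itself; hence the target is allowed to be any translate l(iota0(j))
    and f is lifted after translation by l^-1. *)
Lemma qfun_lift x y (f : @hom (ei_cat E) x y) (i j : vert (quot_eiq c)) g l :
  x = vact A g (iota0 c i) -> y = vact A l (iota0 c j) ->
  exists m : @hom (ei_cat (quot_eiq c)) i j,
    tag (fhom qfun m) = l^-1 * g
    /\ tot (tagged (fhom qfun m)) = tot (fhom (CA l^-1) f).
Proof.
move: x y f i j g l.
apply: ei_hom_ind => [x a|b u x f IH] i j g l.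
  move=> Di Dj.
  have Ep : \pi_(orb (vact A)) (iota0 c i) = \pi_(orb (vact A)) (iota0 c j).
    by apply/orbP; exists (l^-1 * g); rewrite lactM -Di Dj -lactM mulVg lact1.
  have Eij : i = j by rewrite -(iota0K c i) Ep iota0K.
  subst j.
  have Hs : l^-1 * g \in stab (vact A) (iota0 c i).
    by rewrite inE lactM -Di Dj -lactM mulVg lact1.
  have Dl : vact A l^-1 x = iota0 c i by rewrite Dj -lactM mulVg lact1.
  exists (egrp ((actv Dl a, Subg Hs) : @vgrp (quot_eiq c) i)).
  rewrite qfun_egrp; split=> //.
  rewrite qfun_grp_tot; exact: tot_actv.
move=> Di Dj.
have Tb0 : tgt (aact A l^-1 b) = iota0 c j.
  by rewrite [tgt _]aa_tgt Dj -[LHS]lactM mulVg lact1.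
have [beta [r [Ej Dr]]] := arrow_translate Tb0; subst j.
pose l' := l * sgval (rep r).
have Db : aact A l'^-1 b = iota1 c beta.
  by rewrite invMg lactM -Dr -lactM mulVg lact1.
have Sb : src b = vact A (l' * gsh c beta) (iota0 c (qsrc beta)).
  rewrite lactM -iota_src -Db /= aa_src.
  by rewrite -[RHS](lactM (vact A) l' l'^-1) mulgV lact1.
have [m [Tm Fm]] := IH i (qsrc beta) g _ Di Sb.
(* The remainder is lifted after translation by (l h_r g_b)^-1, and the factor
   h_r g_b carried by the lift of u turns this into translation by l^-1. *)
pose x0 : @abis (quot_eiq c) beta := (acta Db u, cpair (rep r) 1).
exists (mcomp (earr x0) m); rewrite qfun_earr.
have El : sgval (rep r) * gsh c beta * (l' * gsh c beta)^-1 = l^-1.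
  by rewrite !invMg !mulgA mulgK mulgV mul1g.
split.
  rewrite [LHS]tag_skew_comp [tag (qfun_arr _)]qfun_arr_tag Tm.
  by rewrite mulg1 mulgA El.
rewrite (tot_skew_comp (qfun_arr x0) (fhom qfun m)) fhomM.
apply: (tot_comp (C := ei_cat E)).
  rewrite qfun_arr_tot (tot_fhom _ (tot_acta _ _)) -tot_cactM.
  by rewrite invMg mulgA mulgV mul1g.
by rewrite [tag (qfun_arr _)]qfun_arr_tag (tot_fhom _ Fm) -tot_cactM mulg1 El.
Qed.

Lemma qfun_full (i j : ei_cat (quot_eiq c)) (f : @hom D (qfun i) (qfun j)) :
  exists m, fhom qfun m = f.
Proof.
case: f => g f.
have [||m [Tm Fm]] := @qfun_lift _ _ f i j g 1 => //.
  by rewrite lact1.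
exists m; apply: skew_ext => /=; first by rewrite Tm invg1 mul1g.
by rewrite Fm invg1 tot_cact1.
Qed.

(** The value of the functor on a composite, in the form to which
    [unique_factorization] applies: the first factor is in the fibre over an
    actual arrow, and w is the remainder moved to end at its source. *)
Lemma qfun_earr_tot (b : arr (quot_eiq c)) u r k i
  (f : @hom (ei_cat (quot_eiq c)) i (src b)) :
  let g := sgval (rep r) * gsh c b * sgval k in
  exists w : @hom (ei_cat E) (CA g (CA (tag (fhom qfun f)) (iota0 c i)))
               (src (aa (A (sgval (rep r))) (iota1 c b))),
    tot w = tot (fhom (CA g) (tagged (fhom qfun f))) /\
    tot (tagged (fhom qfun
      (mcomp (@earr (quot_eiq c) b (u, cpair (rep r) k)) f)))
    = tot (mcomp (earr (aaU (A (sgval (rep r))) u)) w).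
Proof.
move=> g.
have e : CA g (iota0 c (qsrc b)) = src (aa (A (sgval (rep r))) (iota1 c b)).
  by rewrite -qfun_arr_src aa_src.
exists (hcast erefl e (fhom (CA g) (tagged (fhom qfun f)))).
split; first exact: tot_hcast.
rewrite qfun_earr (tot_skew_comp (qfun_arr _) (fhom qfun f)).
apply: (tot_comp (C := ei_cat E)).
  by rewrite qfun_arr_tot tot_cact_earr.
by rewrite [tag (qfun_arr _)]qfun_arr_tag tot_hcast.
Qed.

(** The ends of f and f' are left independent so that the induction on f can be
    followed by a case analysis of f'. If both have an arrow, unique
    factorization provides an element h of U at the source of h_r(iota1 b) that
    relates the images of their first factors and of their remainders; moved
    back to iota0(s b) and paired with k^-1 k', it gives an element y of the
    middle group of the quotient quiver that relates the first factors, and by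
    induction also the remainders. *)
Lemma qfun_tot_inj i j (f : @hom (ei_cat (quot_eiq c)) i j) i' j'
  (f' : @hom (ei_cat (quot_eiq c)) i' j') :
  tag (fhom qfun f) = tag (fhom qfun f') ->
  tot (tagged (fhom qfun f)) = tot (tagged (fhom qfun f')) -> tot f = tot f'.
Proof.
move: i j f i' j' f'; apply: ei_hom_ind => [i x|b x i f IH].
  apply: ei_hom_ind => [i' x'|b' x' i' f' _].
    rewrite !qfun_egrp !qfun_grp_tot => Et /tot_egrp_inj Ex.
    have Ei : iota0 c i = iota0 c i' := congr1 tag Ex.
    have {}Ei : i = i' by rewrite -(iota0K c i) Ei iota0K.
    subst i'; move: Ex => /(@Tagged_inj _ _ _ _ _) Ex.
    congr (tot (egrp _)).
    by case: x Et Ex => a g; case: x' => a' g' /= /val_inj -> ->.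
  (* An image with an arrow is not an element of a vertex group. *)
  move: x'; apply: quot_setW => u' r' k'.
  have [w [_ ->]] := qfun_earr_tot u' r' k' f'.
  rewrite qfun_egrp qfun_grp_tot => _ /(congr1 (@tfactor _)).
  by have [h ->] := tfactor_comp (aaU (A (sgval (rep r'))) u') w.
apply: ei_hom_ind => [i' x'|b' x' i' f' _].
  move: x; apply: quot_setW => u r k.
  have [w [_ ->]] := qfun_earr_tot u r k f.
  rewrite qfun_egrp qfun_grp_tot => _ /(congr1 (@tfactor _)).
  by have [h ->] := tfactor_comp (aaU (A (sgval (rep r))) u) w.
move: x; apply: quot_setW => u r k; move: x'; apply: quot_setW => u' r' k'.
have [w [Dw ->]] := qfun_earr_tot u r k f.
have [w' [Dw' ->]] := qfun_earr_tot u' r' k' f'.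
rewrite !qfun_earr => Ht /unique_factorization[h HF].
have Ht' : sgval (rep r) * gsh c b * sgval k * tag (fhom qfun f)
   = sgval (rep r') * gsh c b' * sgval k' * tag (fhom qfun f').
  move: Ht; rewrite [tag _]tag_skew_comp [tag (qfun_arr _)]qfun_arr_tag => ->.
  by rewrite [LHS]tag_skew_comp [tag (qfun_arr _)]qfun_arr_tag.
have ET : Tagged (fun b => 'I_(ncos c b)) r' = Tagged _ r.
  by apply: arrow_translate_inj; exact: (congr1 tag HF).
have eb : b' = b := congr1 tag ET.
subst b'; have Er : r' = r by exact: (Tagged_inj ET).
subst r'; have [Hu Hw] := mk_factn_inj HF.
pose g := sgval (rep r) * gsh c b * sgval k.
have e : vact A g^-1
    (src (aa (A (sgval (rep r))) (iota1 c b))) = iota0 c (qsrc b).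
  rewrite aa_src (qfun_arr_src r k : av _ _ = _).
  by rewrite -[LHS](lactM (vact A)) mulVg lact1.
pose y : @vgrp (quot_eiq c) (src b) := (actv e h, k^-1 * k').
have Dx : ((u', cpair (rep r) k') : @abis (quot_eiq c) b)
    = ((u, cpair (rep r) k) : @abis (quot_eiq c) b) <* y.
  rewrite [RHS](quot_rE u r k _ _) mulKVg; congr (_, _).
  apply: (bij_inj (aaU_bij (A (sgval (rep r))) (iota1 c b))).
  (* What remains is h_r(g_b(k(g^-1(h)))) = h. *)
  rewrite Hu aaUr; congr (_ <* _).
  apply: (@Tagged_inj _ (@vgrp E)); rewrite TaggedE; apply: tot_egrp_inj.
  rewrite -[RHS]/(tot (fhom (CA (sgval (rep r))) (egrp _))).
  rewrite (tot_fhom _ (tot_actv _ _)) -tot_cactM (tot_fhom _ (tot_actv _ _)).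
  by rewrite -tot_cactM (tot_fhom _ (tot_actv _ _)) -tot_cactM mulgV tot_cact1.
(* The middle group element passes from the first factor to the remainder. *)
rewrite Dx -earr_r -mcompA; apply: tot_comp => //.
have Df : fhom qfun (mcomp (egrp y) f') = mcomp (qfun_grp y) (fhom qfun f').
  exact: (fhomM qfun (egrp y) f').
apply: IH; rewrite Df.
  rewrite (tag_skew_comp (qfun_grp y) (fhom qfun f')).
  apply: (mulgI g); rewrite Ht'.
  have -> : tag (qfun_grp y) = (sgval k)^-1 * sgval k' by [].
  by rewrite !mulgA mulgK.
rewrite (tot_skew_comp (qfun_grp y) (fhom qfun f')).
apply: (@tot_cact_inj _ _ CA g).
(* After translation by g, the claim reads w = h w' with w' = h^-1 w. *)
rewrite -Dw [RHS](congr1 (@tot _ _ _) (fhomM _ _ _)).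
have -> : tot w = tot (mcomp (egrp h) (mcomp (egrp h^-1) w)).
  by rewrite mcompA egrpM mulgV egrp1 mcomp1m.
apply: (tot_comp (C := ei_cat E)).
  rewrite (tot_fhom _ (qfun_grp_tot y)) (tot_fhom _ (tot_actv _ _)).
  by rewrite -tot_cactM mulgV tot_cact1.
rewrite -Hw Dw' -tot_cactM.
have -> : tag (qfun_grp y) = (sgval k)^-1 * sgval k' by [].
by rewrite !mulgA mulgK.
Qed.

End Quotient.

Theorem theoremA (G : finGroupType) (E : ei_quiver) (A : eiq_action G E)
  (c : quot_choice A) :
  cat_equivalent (ei_cat (quot_eiq c)) (skew_cat (ei_cat_action A)).
Proof.
apply: (fully_faithful_equivalent (F := qfun c)).
- exact: qfun_full.
- move=> x y f f' H; apply: tot_inj; apply: qfun_tot_inj; by rewrite H.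
- exact: qfun_ess_surj.
Qed.
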